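(* Let $\mu,\nu,\kappa\in\{0,1,2,\dots,\infty\}$. (a) Let $T:\mathbb V_{2\mu}\rightrightarrows\mathbb V_{2\nu}$ be a perfect Lagrangian linear relation. Then there exists a non-zero bounded operator $W(T):\ell^2(V_\mu^d)\to\ell^2(V_\nu^d)$, unique up to a scalar factor, such that $$a(w)\,W(T)=W(T)\,a(v)\qquad\text{for all }(v,w)\in T.$$ (b) For any perfect Lagrangian linear relations $T:\mathbb V_{2\mu}\rightrightarrows\mathbb V_{2\nu}$ and $S:\mathbb V_{2\nu}\rightrightarrows\mathbb V_{2\kappa}$, $$W(S)\,W(T)=c(T,S)\,W(ST)\qquad\text{with } c(T,S)\in\mathbb C^\times .$$ (c) For any perfect Lagrangian $T:\mathbb V_{2\mu}\rightrightarrows\mathbb V_{2\nu}$, one has $W(T)^*=W(T^\square)$ (as operators defined up to a nonzero scalar factor).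
   Context: $\mathbb F$ is a finite field of characteristic $p>2$, and $\mathsf{Exp}:\mathbb F\to\mathbb C^\times$ is a fixed nontrivial character of the additive group of $\mathbb F$. For $n=0,1,2,\dots$, $V_n^d$ and $V_n^c$ are two copies of $\mathbb F^n$ (discrete topology). $V_\infty^d$ is the direct sum of countably many copies of $\mathbb F$ with the discrete topology; $V_\infty^c$ is the direct product of countably many copies of $\mathbb F$ with the product topology. For $\mu\in\{0,1,\dots,\infty\}$, $\mathbb V_{2\mu}:=V_\mu^d\oplus V_\mu^c$ (product of the topologies), with the symplectic form $\{(x,y),(x',y')\}=\sum_{j=1}^\mu(x_jy_j'-y_jx_j')$. For $v=(v^d,v^c)\in\mathbb V_{2\mu}$, $a(v)$ is the unitary operator in $\ell^2(V_\mu^d)$ given by $a(v)f(x)=f(x+v^d)\,\mathsf{Exp}\bigl[\sum_j(x_jv_j^c+\tfrac12v_j^dv_j^c)\bigr]$. A linear relation $T:X\rightrightarrows Y$ between $\mathbb F$-linear spaces is a linear subspace of $X\oplus Y$. The product of $T:X\rightrightarrows Y$ and $S:Y\rightrightarrows Z$ is $ST=\{(x,z)\in X\oplus Z:\ \exists y\in Y,\ (x,y)\in T,\ (y,z)\in S\}$. The pseudo-inverse $T^\square:Y\rightrightarrows X$ is the image of $T$ under the transposition of summands of $X\oplus Y$. For $T:X\rightrightarrows Y$: $\ker T=T\cap(X\oplus 0)$; $\operatorname{dom}T$ is the projection of $T$ to $X$; $\operatorname{im}T$ is the projection of $T$ to $Y$; $\operatorname{indef}T=T\cap(0\oplus Y)$.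 $\ker T,\operatorname{dom}T$ are regarded as subspaces of $X$, and $\operatorname{im}T,\operatorname{indef}T$ as subspaces of $Y$. A subspace $Z\subset\mathbb V_{2\mu}$ is codiscrete if it is closed and the quotient $\mathbb V_{2\mu}/Z$ is discrete. Equip $\mathbb V_{2\mu}\oplus\mathbb V_{2\nu}$ with the form $\{(v,w),(v',w')\}=\{v,v'\}_{\mathbb V_{2\mu}}-\{w,w'\}_{\mathbb V_{2\nu}}$. A linear relation $T:\mathbb V_{2\mu}\rightrightarrows\mathbb V_{2\nu}$ is perfect Lagrangian if: (1) $T$ is a maximal isotropic subspace of $\mathbb V_{2\mu}\oplus\mathbb V_{2\nu}$ (in particular $T$ is closed); (2) $\ker T$ and $\operatorname{indef}T$ are compact; (3) $\operatorname{im}T$ and $\operatorname{dom}T$ are codiscrete. The product of two perfect Lagrangian relations is perfect Lagrangian, so $W(ST)$ makes sense. *)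

(* Defs.v *)
From HB Require Import structures.
From mathcomp Require Import all_boot all_order all_algebra generic_quotient.
From mathcomp Require Import complex ring finfield.
From mathcomp Require Import all_classical all_reals all_analysis.
From mathcomp.analysis.showcase Require summability.

Set Implicit Arguments.
Unset Strict Implicit.
Unset Printing Implicit Defensive.

Import Order.TTheory GRing.Theory Num.Theory numFieldNormedType.Exports.

Local Open Scope classical_set_scope.
Local Open Scope ring_scope.

(* An element of {0, 1, ..., infinity}; [None] is infinity. *)
Definition card_oo := option nat.

Definition idx (m : card_oo) : countType :=
  if m is Some n then 'I_n else nat.

Section LinearRelations.
Variables (F : fieldType).

Definition is_subspace (X : lmodType F) (Z : set X) : Prop :=
  GRing.submod_closed (mem Z).

Variables (X Y Z : lmodType F).

Definition rel_comp (S : set (Y * Z)) (T : set (X * Y)) : set (X * Z) :=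
  [set p | exists y, T (p.1, y) /\ S (y, p.2)].

Definition rel_pinv (T : set (X * Y)) : set (Y * X) :=
  [set p | T (p.2, p.1)].

Definition rel_ker (T : set (X * Y)) : set X := [set x | T (x, 0)].
Definition rel_dom (T : set (X * Y)) : set X := [set x | exists y, T (x, y)].
Definition rel_im (T : set (X * Y)) : set Y := [set y | exists x, T (x, y)].
Definition rel_indef (T : set (X * Y)) : set Y := [set y | T (0, y)].

End LinearRelations.

Section CosetSpace.
Variables (X : zmodType) (Z : set X).

Definition coset (x : X) : set X := [set x + z | z in Z].

Definition same_coset (x y : X) : bool := `[< coset x = coset y >].

Fact same_coset_refl : reflexive same_coset.
Proof. by move=> x; apply/asboolP. Qed.

Fact same_coset_sym : symmetric same_coset.
Proof. by move=> x y; apply/asboolP/asboolP => ->. Qed.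

Fact same_coset_trans : transitive same_coset.
Proof. by move=> y x z /asboolP xy /asboolP yz; apply/asboolP; rewrite xy. Qed.

Definition coset_equiv : equiv_rel X :=
  EquivRel same_coset same_coset_refl same_coset_sym same_coset_trans.

(* The set of cosets x + Z, as a quotient of X; no condition on Z is needed to
   define it. *)
Definition coset_space : quotType X := {eq_quot coset_equiv}%qT.

End CosetSpace.

Section SymplecticSpaces.
Variables (F : finFieldType) (m : card_oo).

(* For finite [m] every function on [idx m] has finite support and the product
   topology is discrete, so [Vd] and [Vc] are two copies of the discrete F^m. *)
Definition fin_support : {pred (idx m -> F^o)} :=
  [pred x : idx m -> F^o | `[< finite_set [set j | x j != 0] >]].

Fact fin_support_submod_closed : GRing.submod_closed fin_support.
Proof.
split=> [|a x y]; rewrite !inE.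
  by apply: (@sub_finite_set _ _ set0) => // j /=; rewrite eqxx.
move=> fx fy.
apply: (@sub_finite_set _ _ ([set j | x j != 0] `|` [set j | y j != 0]));
  last first.
  by rewrite finite_setU.
move=> j /= h; have [x0|] := eqVneq (x j) 0; last by left.
right; apply: contraNneq h => y0.
by rewrite [_ j](_ : _ = a *: x j + y j) // x0 y0 scaler0 addr0.
Qed.

HB.instance Definition _ :=
  GRing.isSubmodClosed.Build F (idx m -> F^o) fin_support
    fin_support_submod_closed.

Record Vd : Type :=
  MkVd { vd_val :> idx m -> F^o; vd_valP : vd_val \in fin_support }.

HB.instance Definition _ := [isSub for vd_val].
HB.instance Definition _ := [Choice of Vd by <:].
HB.instance Definition _ := [SubChoice_isSubLmodule of Vd by <:].
HB.instance Definition _ := Topological.copy Vd (discrete_topology Vd).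

Definition Vc : Type := idx m -> F^o.

HB.instance Definition _ := GRing.Lmodule.copy Vc (idx m -> F^o).
HB.instance Definition _ :=
  Topological.copy Vc (prod_topology (fun _ : idx m => discrete_topology F)).

Definition V2 : Type := (Vd * Vc)%type.
HB.instance Definition _ := GRing.Lmodule.on V2.
HB.instance Definition _ := Topological.on V2.

(* [\sum_(j \in A)] is 0 by convention when infinitely many terms are nonzero;
   here the summand is supported on the finite set supp v.1 `|` supp w.1. *)
Definition sform (v w : V2) : F :=
  \sum_(j \in [set: idx m]) ((v.1 : Vd) j * w.2 j - v.2 j * (w.1 : Vd) j).

End SymplecticSpaces.

Section Topology.
Variables (F : finFieldType) (m n : card_oo).
Implicit Type T : set (V2 F m * V2 F n).

Definition codiscrete k (Z : set (V2 F k)) : Prop :=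
  closed Z /\ forall U : set (quotient_topology (coset_space Z)), open U.

Definition rform (p q : V2 F m * V2 F n) : F :=
  sform p.1 q.1 - sform p.2 q.2.

Definition isotropic T : Prop :=
  is_subspace T /\ forall p q, T p -> T q -> rform p q = 0.

Definition maximal_isotropic T : Prop :=
  isotropic T /\ forall T', isotropic T' -> T `<=` T' -> T' = T.

Definition perfect_lagrangian T : Prop :=
  [/\ maximal_isotropic T,
      compact (rel_ker T), compact (rel_indef T),
      codiscrete (rel_im T) & codiscrete (rel_dom T)].

End Topology.

Local Notation normc := ComplexField.Normc.normc.

Lemma normc_ge0 (R : realType) (z : R[i]) : 0 <= normc z.
Proof. by case: z => a b; exact: sqrtr_ge0. Qed.

Section EllTwo.
Variables (R : realType) (X : choiceType).
Local Notation C := (R[i]).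

Definition sqnorm (f : X -> C^o) : \bar R :=
  \esum_(x in [set: X]) (normc (f x) ^+ 2)%:E.

Definition square_summable : {pred (X -> C^o)} :=
  [pred f : X -> C^o | (sqnorm f < +oo)%E].

Lemma sqnorm_le (f : X -> C^o) (M : R) :
  (forall A : set X, finite_set A ->
    \sum_(x \in A) normc (f x) ^+ 2 <= M) ->
  (sqnorm f <= M%:E)%E.
Proof.
move=> h; apply: ge_ereal_sup => _ [A [fA _] <-].
by rewrite fsumEFin// lee_fin h.
Qed.

Lemma sqnorm_ge (f : X -> C^o) (A : set X) : finite_set A ->
  ((\sum_(x \in A) normc (f x) ^+ 2)%:E <= sqnorm f)%E.
Proof.
by move=> fA; rewrite -fsumEFin//; apply: ereal_sup_ubound; exists A.
Qed.

Lemma sqnorm_ge0 (f : X -> C^o) : (0 <= sqnorm f)%E.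
Proof. by apply: esum_ge0 => x _; rewrite lee_fin sqr_ge0. Qed.

Lemma square_summable_fin (f : X -> C^o) :
  f \in square_summable -> sqnorm f = (fine (sqnorm f))%:E.
Proof. by move=> ff; rewrite fineK// ge0_fin_numE// sqnorm_ge0. Qed.

Fact square_summable_submod_closed : GRing.submod_closed square_summable.
Proof.
split=> [|a f g ff fg]; rewrite !inE.
  apply: (@le_lt_trans _ _ 0%:E); last exact: ltry.
  apply: sqnorm_le => A fA; rewrite fsbig1// => x _.
  by rewrite ComplexField.Normc.normc0 expr0n.
pose N : C -> R := @ComplexField.Normc.normc R.
have {}ff := square_summable_fin ff; have {}fg := square_summable_fin fg.
pose M := 2 * (N a ^+ 2 * fine (sqnorm f) + fine (sqnorm g)).
apply: (@le_lt_trans _ _ M%:E); last exact: ltry.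
apply: sqnorm_le => A fA.
have le2 x : N ((a *: f + g) x) ^+ 2 <=
    2 * (N a ^+ 2 * N (f x) ^+ 2 + N (g x) ^+ 2).
  have h : N ((a *: f + g) x) <= N a * N (f x) + N (g x).
    by rewrite -ComplexField.Normc.normcM; exact: le_normcD.
  have h0 : 0 <= N ((a *: f + g) x) by exact: normc_ge0.
  apply: (@le_trans _ _ ((N a * N (f x) + N (g x)) ^+ 2)).
    by rewrite lerXn2r // nnegrE (le_trans h0 h).
  rewrite -subr_ge0.
  by rewrite [X in 0 <= X](_ : _ = (N a * N (f x) - N (g x)) ^+ 2) ?sqr_ge0//; ring.
have := sqnorm_ge f fA; have := sqnorm_ge g fA; rewrite ff fg !lee_fin.
rewrite !fsbig_finite//= => hg hf.
apply: (le_trans (ler_sum _ (fun x _ => le2 x))).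
rewrite -mulr_sumr big_split/= -mulr_sumr ler_wpM2l// lerD// ler_wpM2l//.
exact: sqr_ge0.
Qed.

HB.instance Definition _ :=
  GRing.isSubmodClosed.Build C (X -> C^o) square_summable
    square_summable_submod_closed.

Record l2 : Type :=
  MkL2 { l2_val :> X -> C^o; l2_valP : l2_val \in square_summable }.

HB.instance Definition _ := [isSub for l2_val].
HB.instance Definition _ := [Choice of l2 by <:].
HB.instance Definition _ := [SubChoice_isSubLmodule of l2 by <:].

Definition l2norm (f : l2) : R := Num.sqrt (fine (sqnorm f)).

(* The limit of the finite partial sums along the directed set of finite subsets
   of [X]; it exists by absolute convergence. *)
Definition l2dot (f g : l2) : C :=
  summability.sum (fun x => (f x * (g x)^*) : C^o).

End EllTwo.

Section Operators.
Variables (R : realType) (X Y : choiceType).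

Definition bounded_operator (A : {linear l2 R X -> l2 R Y}) : Prop :=
  exists M : R, forall f, l2norm (A f) <= M * l2norm f.

Definition is_adjoint (A : {linear l2 R X -> l2 R Y})
    (B : {linear l2 R Y -> l2 R X}) : Prop :=
  forall f g, l2dot (A f) g = l2dot f (B g).

End Operators.

(* Characters F -> C^* of the additive group of F. *)
Record addchar (F : finFieldType) (R : realType) := AddChar {
  addchar_fun :> F -> R[i];
  addchar_neq0 : forall a, addchar_fun a != 0;
  addcharD : {morph addchar_fun : a b / a + b >-> a * b}
}.

Definition nontrivial (F : finFieldType) (R : realType) (Exp : addchar F R) :
  Prop := exists a, Exp a != 1.

Section Heisenberg.
Variables (F : finFieldType) (R : realType) (Exp : addchar F R) (m : card_oo).
Implicit Types (v : V2 F m) (f : l2 R (Vd F m)).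

Lemma normc_addchar (a : F) : normc (Exp a) = 1.
Proof.
have E0 : Exp 0 = 1.
  by apply: (mulfI (addchar_neq0 Exp 0)); rewrite -addcharD addr0 mulr1.
have Emul k : Exp (a *+ k) = Exp a ^+ k.
  by elim: k => [|k IH]; rewrite ?mulr0n// mulrS addcharD IH exprS.
have [p pp pF] := finPcharP F.
have : Exp a ^+ p = 1 by rewrite -Emul mulrn_pchar.
move=> /(congr1 (@ComplexField.Normc.normc R)).
have -> : normc (Exp a ^+ p) = normc (Exp a) ^+ p.
  elim: (p) => [|k IH]; first by rewrite !expr0 ComplexField.Normc.normc1.
  by rewrite !exprS ComplexField.Normc.normcM IH.
rewrite ComplexField.Normc.normc1 => /eqP.
by rewrite pexpr_eq1 ?prime_gt0// ?normc_ge0// => /eqP.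
Qed.

Definition heisenberg_fun v f : Vd F m -> R[i]^o := fun x =>
  f (x + v.1) *
  Exp (\sum_(j \in [set: idx m])
        ((x : Vd F m) j * v.2 j + 2^-1 * (v.1 : Vd F m) j * v.2 j)).

Fact heisenberg_subproof v f : heisenberg_fun v f \in @square_summable R (Vd F m).
Proof.
rewrite inE; apply: le_lt_trans (l2_valP f).
rewrite /sqnorm [leRHS](@reindex_esum _ _ _ [set: Vd F m] [set: Vd F m]
  (fun x => x + v.1)); last first.
  by rewrite setTT_bijective; exists (fun x => x - v.1) => x; rewrite (addrK, subrK).
apply: le_esum => x _.
by rewrite ComplexField.Normc.normcM normc_addchar mulr1.
Qed.

Definition heisenberg v f : l2 R (Vd F m) := MkL2 (heisenberg_subproof v f).

End Heisenberg.

Definition weil_operator (F : finFieldType) (R : realType) (Exp : addchar F R)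
    (m n : card_oo) (T : set (V2 F m * V2 F n))
    (A : {linear l2 R (Vd F m) -> l2 R (Vd F n)}) : Prop :=
  [/\ bounded_operator A, exists f, A f != 0 &
      forall v w f, T (v, w) ->
        heisenberg Exp w (A f) = A (heisenberg Exp v f)].

(* Main.v *)
From HB Require Import structures.
Require Import Defs.
From mathcomp Require Import all_boot all_order all_algebra.
From mathcomp Require Import complex ring lra finmap.
From mathcomp Require Import all_classical all_reals all_analysis.
From mathcomp.analysis.showcase Require summability.

Set Implicit Arguments.
Unset Strict Implicit.
Unset Printing Implicit Defensive.

Import Order.TTheory GRing.Theory Num.Theory numFieldNormedType.Exports.
Local Open Scope classical_set_scope.
Local Open Scope ring_scope.

(** Write an element of V_2m as a pair (x, u) with x in the discrete half and u
    in the compact half, and x.u for the pairing of the two halves ([dotp]).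
    A bounded operator W on l^2 is determined by its kernel
    K(x, y) = (W delta_x)(y).  For (v, w) in T, the equation a(w) W = W a(v)
    says that translating the argument of K by the discrete parts of v and w
    multiplies K by an explicit value of the character.  Hence K(0, 0)
    determines K on the projection P of T to the discrete halves
    ([disc_proj]).  The vectors of T with zero discrete part are exactly the
    annihilator of P, because T is maximal isotropic; the translation rule for
    them forces K to vanish outside the biorthogonal of P, which is P itself
    ([disc_proj_biorth]).  So W is unique up to a scalar
    ([weil_operator_unique]), and the candidate kernel is Exp of a quadratic
    form on P, extended by zero ([weil_kernel]).

    Its entries have modulus at most 1, so by Schur's test it defines a bounded
    operator as soon as the rows and columns of P have bounded finite size,
    that is, as soon as the slices of P through 0 ([disc_dom] and [disc_im])
    are finite.  This finiteness is what perfection means for a maximal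
    isotropic T ([perfect_lagrangianP]).  If dom T is open and the slice is
    infinite, then its elements have infinitely many leading positions, and
    lifting the indicator functions of sets of such positions through T embeds
    the power set of an infinite set into a countable group
    ([finite_disc_dom]).  Conversely finite slices give compact kernels by
    Tychonoff and open domains by duality.

    For a product ST, finiteness of the slices is immediate, and maximality is
    a Hahn-Banach argument: a vector (v, z) orthogonal to ST defines a linear
    form on im T + dom S which vanishes on small vectors of the compact half,
    so that it is the pairing with some y, and then (v, y) lies in T and (y, z)
    in S ([maximal_isotropic_comp]).  The operator W(S) W(T) intertwines ST, so
    by uniqueness it only has to be nonzero.  Its entry at (0, 0) is a
    quadratic Gauss sum over a finite space E; in odd characteristic the square
    of its modulus is |E| times the size of the radical, hence nonzero
    ([gauss_sum_neq0]).

    Finally the kernel of the pseudo-inverse is the conjugate transpose of the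
    kernel of T, and bounded operators with conjugate transposed kernels are
    adjoint to each other ([is_adjointI]). *)

(** * Subspaces, their cosets and separation of vectors *)
Section Subspaces.
Variables (F : fieldType).
Implicit Types (E : lmodType F).

Lemma subspaceP E (Z : set E) :
  is_subspace Z <-> Z 0 /\ forall a u v, Z u -> Z v -> Z (a *: u + v).
Proof.
split=> [[Z0 Zl]|[Z0 Zl]].
  split=> [|a u v Zu Zv]; first by have := Z0; rewrite inE.
  by have := Zl a u v; rewrite !inE; apply.
by split=> [|a u v]; rewrite !inE//; exact: Zl.
Qed.

Lemma subspace0 E (Z : set E) : is_subspace Z -> Z 0.
Proof. by move=> /subspaceP[]. Qed.

Lemma subspaceL E (Z : set E) a u v :
  is_subspace Z -> Z u -> Z v -> Z (a *: u + v).
Proof. by move=> /subspaceP[_]; apply. Qed.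

Lemma subspaceZ E (Z : set E) a u : is_subspace Z -> Z u -> Z (a *: u).
Proof.
by move=> sZ Zu; rewrite -[_ *: _]addr0; apply: subspaceL => //; exact: subspace0.
Qed.

Lemma subspaceD E (Z : set E) u v : is_subspace Z -> Z u -> Z v -> Z (u + v).
Proof. by move=> sZ Zu Zv; rewrite -[u]scale1r; exact: subspaceL. Qed.

Lemma subspaceN E (Z : set E) u : is_subspace Z -> Z u -> Z (- u).
Proof. by move=> sZ Zu; rewrite -scaleN1r; exact: subspaceZ. Qed.

Lemma subspaceB E (Z : set E) u v : is_subspace Z -> Z u -> Z v -> Z (u - v).
Proof. by move=> sZ Zu Zv; apply: subspaceD => //; exact: subspaceN. Qed.

(** By maximality of N, adding any vector e outside N brings in x, so e lies in
    N + F x; thus N is a hyperplane complementary to x. *)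
Lemma subspace_maximal_avoiding E (M : set E) (x : E) :
  is_subspace M -> ~ M x ->
  exists N, [/\ is_subspace N, M `<=` N, ~ N x &
    forall e, exists c, N (e - c *: x)].
Proof.
move=> sM Mx.
pose P (A : set E) := is_subspace (M `|` A) /\ ~ (M `|` A) x.
have chainP (C : set (set E)) : C `<=` P -> total_on C subset ->
    P (\bigcup_(X in C) X).
  move=> CP tC.
  have [C0|/set0P[X0 CX0]] := eqVneq C set0.
    by rewrite /P C0 bigcup_set0 setU0.
  have common u v : (M `|` \bigcup_(X in C) X) u ->
      (M `|` \bigcup_(X in C) X) v ->
      exists X, [/\ C X, (M `|` X) u & (M `|` X) v].
    case=> [Mu|[X CX Xu]]; case=> [Mv|[Y CY Yv]].
    - by exists X0; split=> //; left.
    - by exists Y; split=> //; [left|right].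
    - by exists X; split=> //; [right|left].
    - have [XY|YX] := tC _ _ CX CY.
        by exists Y; split=> //; right=> //; exact: XY.
      by exists X; split=> //; right=> //; exact: YX.
  split.
    apply/subspaceP; split; first by left; exact: subspace0.
    move=> a u v hu hv; have [X [CX Xu Xv]] := common _ _ hu hv.
    have [sX _] := CP _ CX.
    have [h|h] : (M `|` X) (a *: u + v) by exact: subspaceL.
      by left.
    by right; exists X.
  case=> [//|[X CX Xx]]; have [_] := CP _ CX; apply; by right.
(* [P] speaks of M `|` A and not of A, so that the empty chain is harmless *)
have [A [[sN Nx] maxA]] := Zorn_bigcup chainP.
exists (M `|` A); split=> // e.
have [Ne|nNe] := pselect ((M `|` A) e).
  by exists 0; rewrite scale0r subr0.
pose N' := [set z | exists a, (M `|` A) (z - a *: e)].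
have sN' : is_subspace N'.
  apply/subspaceP; split=> [|a u v [b hb] [c hc]].
    by exists 0; rewrite scale0r subr0; exact: subspace0.
  exists (a * b + c).
  have -> : a *: u + v - (a * b + c) *: e = a *: (u - b *: e) + (v - c *: e).
    by rewrite scalerDl scalerBr scalerA opprD !addrA; congr (_ - _); rewrite addrAC.
  exact: subspaceL.
have N'e : N' e by exists 1; rewrite scale1r subrr; exact: subspace0.
have NN' : M `|` A `<=` N' by move=> z Nz; exists 0; rewrite scale0r subr0.
have [a Na] : N' x.
  apply: contrapT => nx; apply: (maxA N').
    split; first by move=> z Az; apply: NN'; right.
    by move=> N'A; apply: nNe; right; exact: N'A.
  have E1 : M `|` N' = N'.
    by apply/seteqP; split=> [z [Mz|//]|z]; [apply: NN'; left|right].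
  by rewrite /P E1.
have a0 : a != 0.
  by apply/eqP => a0; apply: Nx; move: Na; rewrite a0 scale0r subr0.
exists a^-1.
have -> : e - a^-1 *: x = (- a^-1) *: (x - a *: e).
  by rewrite scalerBr !scaleNr scalerA mulVf// scale1r opprK addrC.
exact: subspaceZ.
Qed.

(** The functional reads off the coordinate along x in a decomposition
    E = N + F x with M inside N. *)
Lemma subspace_separation E (M : set E) (x : E) : is_subspace M -> ~ M x ->
  exists phi : {linear E -> F^o}, (forall m, M m -> phi m = 0) /\ phi x = 1.
Proof.
move=> sM Mx; have [N [sN MN Nx hN]] := subspace_maximal_avoiding sM Mx.
have uniqN e c d : N (e - c *: x) -> N (e - d *: x) -> c = d.
  move=> hc hd; apply/eqP; rewrite -subr_eq0; apply/eqP/eqP/negP => /negP cd.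
  apply: Nx.
  have -> : x = (c - d)^-1 *: ((e - d *: x) - (e - c *: x)).
    rewrite [X in _ *: X](_ : _ = (c - d) *: x) ?scalerA ?mulVf ?scale1r//.
    by rewrite scalerBl opprB addrC addrA subrK.
  by apply: subspaceZ => //; exact: subspaceB.
pose phi e : F^o := projT1 (cid (hN e)).
have phiP e : N (e - phi e *: x) by rewrite /phi; case: cid.
have phiE e c : N (e - c *: x) -> phi e = c by exact: uniqN.
have phiL : linear phi.
  move=> a u v; apply: phiE.
  have -> : a *: u + v - (a *: phi u + phi v) *: x =
      a *: (u - phi u *: x) + (v - phi v *: x).
    rewrite scalerDl scalerBr scalerA opprD !addrA; congr (_ - _).
    by rewrite addrAC.
  exact: subspaceL.
pose H := GRing.isLinear.Build F E F^o *:%R phi phiL.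
pose f : {linear E -> F^o} := HB.pack phi H.
exists f; split=> [m Mm|] /=; apply: phiE.
  by rewrite scale0r subr0; exact: MN.
by rewrite scale1r subrr; exact: subspace0.
Qed.

Lemma fset_subspace_translate E (V : nmodType) (D : {fset E}) (z : E)
    (f : E -> V) :
  is_subspace [set` D] -> z \in D ->
  \sum_(y <- D) f (y + z) = \sum_(y <- D) f y.
Proof.
move=> sD zD; pose tr y := y + z; have h : [fset tr y | y in D]%fset =i D.
  move=> y; apply/imfsetP/idP => /= [[x xD ->]|yD].
    exact: (subspaceD sD xD zD).
  by exists (y - z); rewrite /tr ?subrK//; exact: (subspaceB sD yD zD).
rewrite -[RHS](eq_fbigl _ _ h) big_imfset//=.
by move=> x y _ _ /addIr.
Qed.

(** Meant for the fibres of a subgroup of a product: the differences of the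
    elements of a fibre lie in the fibre over 0. *)
Lemma card_slice (E : zmodType) (D : {fset E}) (Q : set E) :
  (forall x y, Q x -> Q y -> x - y \in D) ->
  exists A : {fset E}, (#|` A| <= #|` D|)%N /\ forall x, Q x -> x \in A.
Proof.
move=> hQ; have [->|/set0P[x0 Qx0]] := eqVneq Q set0.
  by exists fset0; split.
pose tr d := x0 + d; exists [fset tr d | d in D]%fset; split; first exact: leq_imfset_card.
move=> x Qx; apply/imfsetP; exists (x - x0); first exact: hQ.
by rewrite /tr addrC subrK.
Qed.

Lemma pairl_linear E E' : linear (fun x : E => (x, 0) : E * E').
Proof.
move=> a x y; apply/pair_equal_spec; split=> //=.
by rewrite [RHS](_ : _ = a *: 0 + 0)// scaler0 addr0.
Qed.

Lemma pairr_linear E E' : linear (fun x : E' => (0, x) : E * E').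
Proof.
move=> a x y; apply/pair_equal_spec; split=> //=.
by rewrite [RHS](_ : _ = a *: 0 + 0)// scaler0 addr0.
Qed.

Definition pairl E E' : {linear E -> (E * E')%type} :=
  HB.pack (fun x : E => (x, 0) : E * E')
    (GRing.isLinear.Build F _ _ _ _ (@pairl_linear E E')).

Definition pairr E E' : {linear E' -> (E * E')%type} :=
  HB.pack (fun x : E' => (0, x) : E * E')
    (GRing.isLinear.Build F _ _ _ _ (@pairr_linear E E')).

End Subspaces.

(** * The pairing of the discrete and compact halves *)
Section Pairing.
Variables (F : finFieldType) (m : card_oo).
Implicit Types (x y : Vd F m) (c d : Vc F m) (v w : V2 F m).

Definition dotp x c : F := \sum_(j \in [set: idx m]) x j * c j.

Lemma vd_finite x : finite_set [set j | x j != 0].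
Proof. by have := vd_valP x; rewrite inE. Qed.

Lemma vdP x y : (forall j, x j = y j) -> x = y.
Proof. by move=> h; apply: val_inj; apply: funext. Qed.

Lemma vdlE a x y j : (a *: x + y) j = a * x j + y j.
Proof. by []. Qed.

Lemma dotpE (A : set (idx m)) x c : finite_set A ->
  (forall j, x j != 0 -> A j) -> dotp x c = \sum_(j <- fset_set A) x j * c j.
Proof.
move=> fA xA; rewrite /dotp -(@fsbig_widen _ _ _ _ A setT)//.
  by rewrite fsbig_finite.
move=> j [_ /= nA]; have [->|/xA//] := eqVneq (x j) 0.
by rewrite mul0r.
Qed.

Lemma dotp_linl a x y c : dotp (a *: x + y) c = a * dotp x c + dotp y c.
Proof.
pose A := [set j | x j != 0] `|` [set j | y j != 0].
have fA : finite_set A by rewrite finite_setU; split; exact: vd_finite.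
rewrite !(dotpE (A := A))//; last 3 first.
- by move=> j h; right.
- by move=> j h; left.
- move=> j; rewrite vdlE; have [x0|h _] := eqVneq (x j) 0; last by left.
  by rewrite x0 mulr0 add0r; right.
rewrite mulr_sumr -big_split/=; apply: eq_bigr => j _.
by rewrite [LHS](_ : _ = (a * x j + y j) * c j)// mulrDl mulrA.
Qed.

Lemma dotp_linr a x c d : dotp x (a *: c + d) = a * dotp x c + dotp x d.
Proof.
have fA := vd_finite x; rewrite !(dotpE _ fA)//.
rewrite mulr_sumr -big_split/=; apply: eq_bigr => j _.
by rewrite [LHS](_ : _ = x j * (a * c j + d j))// mulrDr mulrCA.
Qed.

Lemma dotp0l c : dotp 0 c = 0.
Proof. by rewrite /dotp fsbig1// => j _; rewrite mul0r. Qed.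

Lemma dotp0r x : dotp x 0 = 0.
Proof. by rewrite /dotp fsbig1// => j _; rewrite mulr0. Qed.

Lemma dotpDl x y c : dotp (x + y) c = dotp x c + dotp y c.
Proof. by rewrite -[x]scale1r dotp_linl mul1r scale1r. Qed.

Lemma dotpDr x c d : dotp x (c + d) = dotp x c + dotp x d.
Proof. by rewrite -[c]scale1r dotp_linr mul1r scale1r. Qed.

Lemma dotpZl a x c : dotp (a *: x) c = a * dotp x c.
Proof. by rewrite -[_ *: x]addr0 dotp_linl dotp0l addr0. Qed.

Lemma dotpZr a x c : dotp x (a *: c) = a * dotp x c.
Proof. by rewrite -[_ *: c]addr0 dotp_linr dotp0r addr0. Qed.

Lemma dotpNl x c : dotp (- x) c = - dotp x c.
Proof. by rewrite -scaleN1r dotpZl mulN1r. Qed.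

Lemma dotpNr x c : dotp x (- c) = - dotp x c.
Proof. by rewrite -scaleN1r dotpZr mulN1r. Qed.

Lemma sformE v w : sform v w = dotp v.1 w.2 - dotp w.1 v.2.
Proof.
pose A := [set j | (v.1 : Vd F m) j != 0] `|` [set j | (w.1 : Vd F m) j != 0].
have fA : finite_set A by rewrite finite_setU; split; exact: vd_finite.
rewrite !(dotpE (A := A))//; last 2 first.
- by move=> j h; right.
- by move=> j h; left.
rewrite /sform -(@fsbig_widen _ _ _ _ A setT)//.
  rewrite fsbig_finite//= -sumrB; apply: eq_bigr => j _.
  by rewrite [_.2 j * _]mulrC.
move=> j [_ /= /not_orP[/negP + /negP]]; rewrite !negbK => /eqP -> /eqP ->.
by rewrite mul0r mulr0 subr0.
Qed.

Definition vd_delta_fun (i : idx m) : idx m -> F^o := fun j => (j == i)%:R.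

Fact vd_delta_subproof i : vd_delta_fun i \in @fin_support F m.
Proof.
rewrite inE; apply: (@sub_finite_set _ _ [set i]) => // j /=.
by rewrite /vd_delta_fun; have [->|] := eqVneq j i; rewrite ?eqxx.
Qed.

Definition vd_delta i : Vd F m := MkVd (vd_delta_subproof i).

Lemma vd_sum_delta x :
  x = \sum_(j <- fset_set [set j | x j != 0]) (x j : F) *: vd_delta j.
Proof.
apply: vdP => i; have fA := vd_finite x.
have sumE (s : seq (idx m)) :
    ((\sum_(j <- s) (x j : F) *: vd_delta j : Vd F m) : idx m -> F^o) i =
    \sum_(j <- s) x j * (i == j)%:R.
  by elim: s => [|j s IH]; rewrite ?big_nil// !big_cons -IH.
rewrite sumE.
have [xi0|xi0] := eqVneq (x i) 0.
  rewrite big1 ?xi0// => j _; have [<-|] := eqVneq i j; last by rewrite mulr0.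
  by rewrite xi0 mul0r.
rewrite (big_fsetD1 i)/=; last by rewrite in_fset_set// inE.
rewrite eqxx mulr1 big1_fset ?addr0// => j; rewrite !inE => /andP[ji _] _.
by rewrite eq_sym (negbTE ji) mulr0.
Qed.

(** Vd has the deltas as a basis, so its full algebraic dual is Vc: no
    continuity condition appears. *)
Lemma linear_dotp (phi : {linear Vd F m -> F^o}) :
  exists c : Vc F m, forall x, phi x = dotp x c.
Proof.
exists (fun i => phi (vd_delta i)) => x.
rewrite [x in LHS]vd_sum_delta linear_sum (dotpE _ (vd_finite x))//=.
by apply: eq_bigr => j _; rewrite linearZ.
Qed.

End Pairing.

(** * The symplectic form *)
Section SymplecticForm.
Variables (F : finFieldType) (m : card_oo).
Implicit Types (u v w : V2 F m).

Lemma sform_linr a u v w : sform u (a *: v + w) = a * sform u v + sform u w.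
Proof. by rewrite !sformE /= dotp_linr dotp_linl; ring. Qed.

Lemma sformC v w : sform v w = - sform w v.
Proof. by rewrite !sformE opprB. Qed.

Lemma sform_linl a u v w : sform (a *: u + v) w = a * sform u w + sform v w.
Proof. by rewrite sformC sform_linr [sform w u]sformC [sform w v]sformC; ring. Qed.

Lemma sformvv v : sform v v = 0.
Proof. by rewrite sformE subrr. Qed.

Lemma sform0r v : sform v 0 = 0.
Proof. by rewrite sformE dotp0r dotp0l subrr. Qed.

Lemma sformDr u v w : sform u (v + w) = sform u v + sform u w.
Proof. by rewrite -[v]scale1r sform_linr mul1r scale1r. Qed.

Lemma sformNr u v : sform u (- v) = - sform u v.
Proof. by rewrite -[- v]addr0 -scaleN1r sform_linr sform0r addr0 mulN1r. Qed.

(** A fundamental system of neighbourhoods of 0 for the product topology, the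
    coordinates being enumerated by [pickle]. *)
Definition vc_ball k : set (Vc F m) :=
  [set c | forall j, (choice.pickle j < k)%N -> c j = 0].

Lemma vc_ball_subspace k : is_subspace (vc_ball k).
Proof.
apply/subspaceP; split=> [//|a c d hc hd j jk].
by rewrite [LHS](_ : _ = a * c j + d j)// hc// hd// mulr0 addr0.
Qed.

Lemma vc_ball_le k l : (k <= l)%N -> vc_ball l `<=` vc_ball k.
Proof. by move=> kl c hc j jk; apply: hc; exact: leq_trans kl. Qed.

Lemma finite_pickle_lt k : finite_set [set j : idx m | (choice.pickle j < k)%N].
Proof.
apply: (@sub_finite_set _ _ [set` pmap (@choice.unpickle (idx m)) (iota 0 k)]) => //.
move=> j /= jk; rewrite mem_pmap; apply/mapP; exists (choice.pickle j).
  by rewrite mem_iota.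
by rewrite choice.pickleK.
Qed.

Lemma vd_vc_ball (x : Vd F m) : exists k, forall c, vc_ball k c -> dotp x c = 0.
Proof.
pose s := fset_set [set j | x j != 0].
exists (\max_(j <- s) (choice.pickle j).+1)%N => c hc.
rewrite (dotpE _ (vd_finite x))// big_seq big1// => j js.
by rewrite hc ?mulr0//; rewrite (big_fsetD1 j)//= leq_max ltnSn.
Qed.

Lemma finite_vd_vc_ball (A : set (Vd F m)) : finite_set A ->
  exists k, forall x c, A x -> vc_ball k c -> dotp x c = 0.
Proof.
move=> /finite_seqP[s ->]; elim: s => [|x s [k IH]]; first by exists 0%N.
have [l hl] := vd_vc_ball x.
exists (maxn k l) => y c; rewrite /= inE => /predU1P[->|ys] hc.
  by apply: hl; apply: vc_ball_le hc; exact: leq_maxr.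
by apply: IH => //; apply: vc_ball_le hc; exact: leq_maxl.
Qed.

(** The continuous functionals on the compact half come from the discrete half:
    modulo the ball of index k only finitely many coordinates remain. *)
Lemma linear_vc_ball (phi : {linear Vc F m -> F^o}) k :
  (forall c, vc_ball k c -> phi c = 0) ->
  exists x : Vd F m, forall c, phi c = dotp x c.
Proof.
move=> phi0.
pose e (i : idx m) : Vc F m := fun j => (j == i)%:R.
pose xf : idx m -> F^o := fun j => if (choice.pickle j < k)%N then phi (e j) else 0.
have xfP : xf \in @fin_support F m.
  rewrite inE; apply: sub_finite_set (finite_pickle_lt k) => j /=.
  by rewrite /xf; case: ifP => //; rewrite eqxx.
exists (MkVd xfP) => c; have fk := finite_pickle_lt k.
pose s := fset_set [set j : idx m | (choice.pickle j < k)%N].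
have sE j : (j \in s) = (choice.pickle j < k)%N.
  by rewrite in_fset_set//; apply/idP/idP; rewrite inE.
pose d : Vc F m := \sum_(j <- s) (c j : F) *: e j.
have dE i : d i = \sum_(j <- s) (c j : F) * (i == j)%:R.
  rewrite /d; elim: (enum_fset s) => [|j r IH]; first by rewrite !big_nil.
  by rewrite !big_cons -IH.
have cd : vc_ball k (c - d).
  move=> i ik; rewrite [LHS](_ : _ = c i - d i)// dE (big_fsetD1 i)/= ?sE//.
  rewrite eqxx mulr1 big1_fset ?addr0 ?subrr// => j; rewrite !inE => /andP[ji _] _.
  by rewrite eq_sym (negbTE ji) mulr0.
rewrite -[c in LHS](subrK d) linearD phi0// add0r /d linear_sum.
rewrite (dotpE (A := [set j : idx m | (choice.pickle j < k)%N]))//; last first.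
  by move=> j /=; rewrite /xf; case: ifP => //; rewrite eqxx.
rewrite big_seq [RHS]big_seq; apply: eq_bigr => j; rewrite sE => jk.
by rewrite linearZ /= /xf jk mulrC.
Qed.

(** Here G is the graph of a linear form on a subspace containing a ball of the
    compact half, on which the form vanishes.  Separating (0, 1) from G extends
    the form to the whole space, and continuity makes it a symplectic pairing. *)
Lemma sform_extension k (G : set (V2 F m * F^o)) :
  is_subspace G -> ~ G (0, 1) ->
  (forall c, vc_ball k c -> G ((0, c), 0)) ->
  exists y, forall w t, G (w, t) -> t = sform y w.
Proof.
move=> sG G01 Gk; have [phi [phi0 phi1]] := subspace_separation sG G01.
pose i1 : {linear Vd F m -> (V2 F m * F^o)%type} :=
  pairl (V2 F m) F^o \o pairl (Vd F m) (Vc F m).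
pose i2 : {linear Vc F m -> (V2 F m * F^o)%type} :=
  pairl (V2 F m) F^o \o pairr (Vd F m) (Vc F m).
have [c0 phid] := linear_dotp (phi \o i1).
have [|x0 phic] := @linear_vc_ball (phi \o i2) k.
  by move=> c hc /=; apply: phi0; exact: Gk.
exists (- x0, c0) => -[x c] t /phi0.
have -> : ((x, c), t) = i1 x + i2 c + (t : F) *: ((0, 1) : (V2 F m * F^o)%type).
  apply: injective_projections; last by rewrite /= !add0r /GRing.scale/= mulr1.
  by apply: injective_projections; rewrite /= ?addr0 ?add0r scaler0 addr0.
rewrite !linearD linearZ phi1 -[phi (i1 x)]/((phi \o i1) x) phid.
rewrite -[phi (i2 c)]/((phi \o i2) c) phic sformE /= dotpNl => /eqP.
rewrite [_ *: 1]mulr1 addr_eq0 => /eqP tE.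
by rewrite -[t]opprK -tE opprD addrC.
Qed.

End SymplecticForm.

(** * Maximal isotropic relations *)
Section Lagrangian.
Variables (F : finFieldType).

Section OneRelation.
Variables (m n : card_oo).
Implicit Types (T : set (V2 F m * V2 F n)) (p q : V2 F m * V2 F n).

Lemma rform_linl a p q r : rform (a *: p + q) r = a * rform p r + rform q r.
Proof. by rewrite /rform /= !sform_linl; ring. Qed.

Lemma rformC p q : rform p q = - rform q p.
Proof. by rewrite /rform sformC [sform p.2 _]sformC; ring. Qed.

Lemma rform_linr a p q r : rform r (a *: p + q) = a * rform r p + rform r q.
Proof. by rewrite rformC rform_linl [rform p _]rformC [rform q _]rformC; ring. Qed.

Lemma rformvv p : rform p p = 0.
Proof. by rewrite /rform !sformvv subrr. Qed.

(** The form is alternating, so T + F p is again isotropic. *)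
Lemma maximal_isotropic_orth T p : maximal_isotropic T ->
  (forall q, T q -> rform p q = 0) -> T p.
Proof.
move=> [[sT iT] maxT] pT.
pose T' := [set q | exists a t, T t /\ q = a *: p + t].
have TT' : T `<=` T' by move=> t Tt; exists 0, t; rewrite scale0r add0r.
rewrite -(maxT T')//; first by exists 1, 0; rewrite scale1r addr0; split=> //; exact: subspace0.
split.
  apply/subspaceP; split; first by apply: TT'; exact: subspace0.
  move=> a _ _ [b [t [Tt ->]]] [c [s [Ts ->]]].
  exists (a * b + c), (a *: t + s); split; first exact: subspaceL.
  by rewrite scalerDr scalerA scalerDl !addrA; congr (_ + _); rewrite addrAC.
move=> _ _ [b [t [Tt ->]]] [c [s [Ts ->]]].
rewrite rform_linl !rform_linr rformvv [rform t p]rformC !pT// iT//.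
by ring.
Qed.

Lemma maximal_isotropicI T : isotropic T ->
  (forall p, (forall q, T q -> rform p q = 0) -> T p) -> maximal_isotropic T.
Proof.
move=> iT hT; split=> // T' [_ iT'] TT'; apply/seteqP; split=> // p T'p.
by apply: hT => q Tq; apply: iT' => //; exact: TT'.
Qed.

(** The support of the kernel of the Weil operator of T. *)
Definition disc_proj T : set (Vd F m * Vd F n) :=
  [set p | exists u c, T ((p.1, u), (p.2, c))].

Definition disc_im T : set (Vd F n) := [set y | disc_proj T (0, y)].

Definition disc_dom T : set (Vd F m) := [set x | disc_proj T (x, 0)].

Lemma disc_proj_subspace T : is_subspace T -> is_subspace (disc_proj T).
Proof.
move=> sT; apply/subspaceP; split.
  by exists 0, 0; exact: (subspace0 sT).
move=> a [x y] [x' y'] [u [c h]] [u' [c' h']].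
by exists (a *: u + u'), (a *: c + c'); exact: (subspaceL a sT h h').
Qed.

Lemma isotropic_pairing T x y u c a b : isotropic T ->
  T ((0, u), (0, c)) -> T ((x, a), (y, b)) -> dotp x u = dotp y c.
Proof.
move=> [_ iT] h1 h2; have := iT _ _ h2 h1.
rewrite /rform /= !sformE /= !dotp0l !subr0 => /eqP.
by rewrite subr_eq0 => /eqP.
Qed.

(** Together with [isotropic_pairing]: the part of T in the compact halves is
    the annihilator of [disc_proj T]. *)
Lemma compact_part_orth T u c : maximal_isotropic T ->
  (forall x y, disc_proj T (x, y) -> dotp x u = dotp y c) ->
  T ((0, u), (0, c)).
Proof.
move=> mT h; apply: maximal_isotropic_orth => // -[[x a] [y b]] Tq.
rewrite /rform /= !sformE /= !dotp0l !sub0r (h x y) ?subrr//.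
by exists a, b.
Qed.

(** A functional separating (x, y) from [disc_proj T] is given by a pair of
    vectors of the compact halves, and this pair lies in T. *)
Lemma disc_proj_biorth T x y : maximal_isotropic T ->
  (forall u c, T ((0, u), (0, c)) -> dotp x u = dotp y c) -> disc_proj T (x, y).
Proof.
move=> mT h; apply: contrapT => nP.
have [[sT _] _] := mT.
have [phi [phi0 phi1]] := subspace_separation (disc_proj_subspace sT) nP.
pose i1 := pairl (Vd F m) (Vd F n).
pose i2 := pairr (Vd F m) (Vd F n).
have [u phiu] := linear_dotp (phi \o i1).
have [c phic] := linear_dotp (phi \o i2).
have phiE x' y' : phi (x', y') = dotp x' u + dotp y' c.
  rewrite -phiu -phic /= -linearD; congr (phi _).
  by apply: injective_projections; rewrite /= ?addr0 ?add0r.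
have Tuc : T ((0, u), (0, - c)).
  apply: compact_part_orth => // x' y' /phi0; rewrite phiE dotpNr => /eqP.
  by rewrite addr_eq0 => /eqP.
have := h _ _ Tuc; rewrite dotpNr => /eqP; rewrite -addr_eq0 -phiE phi1.
by rewrite oner_eq0.
Qed.

(** The condition on u makes y |-> x.u well defined on the second projection of
    [disc_proj T]; c is any extension of this functional. *)
Lemma compact_part_lift T u : maximal_isotropic T ->
  (forall x, disc_dom T x -> dotp x u = 0) -> exists c, T ((0, u), (0, c)).
Proof.
move=> mT hu; have [[sT _] _] := mT; have sP := disc_proj_subspace sT.
pose G : set (Vd F n * F^o) :=
  [set p | exists x, disc_proj T (x, p.1) /\ p.2 = dotp x u].
have sG : is_subspace G.
  apply/subspaceP; split.
    by exists 0; rewrite dotp0l; split=> //; exact: (subspace0 sP).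
  move=> a [y t] [y' t'] [x [h /= ->]] [x' [h' /= ->]].
  exists (a *: x + x'); rewrite dotp_linl; split=> //.
  exact: (subspaceL a sP h h').
have G01 : ~ G (0, 1).
  by move=> [x [h /= /esym]]; rewrite hu// => /eqP; rewrite eq_sym oner_eq0.
have [phi [phi0 phi1]] := subspace_separation sG G01.
pose i1 := pairl (Vd F n) F^o.
have [c phic] := linear_dotp (phi \o i1).
exists (- c); apply: compact_part_orth => // x y Pxy.
have : phi (y, dotp x u : F^o) = 0 by apply: phi0; exists x.
have -> : ((y, dotp x u) : Vd F n * F^o) =
    i1 y + dotp x u *: ((0, 1) : (Vd F n * F^o)%type).
  apply: injective_projections => /=; first by rewrite scaler0 addr0.
  by rewrite add0r /GRing.scale/= mulr1.
rewrite linearD linearZ phi1 -[phi (i1 y)]/((phi \o i1) y) phic dotpNr.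
rewrite [X in _ + X](_ : _ = dotp x u * 1)// mulr1 addrC => /eqP.
by rewrite addr_eq0 => /eqP.
Qed.

Lemma isotropic_pinv T : isotropic T -> isotropic (rel_pinv T).
Proof.
move=> [sT iT]; split.
  apply/subspaceP; split; first exact: (subspace0 sT).
  by move=> a [x y] [x' y'] h h'; exact: (subspaceL a sT h h').
move=> [x y] [x' y'] h h'; have := iT _ _ h h'.
by rewrite /rform /= -opprB => /eqP; rewrite oppr_eq0 => /eqP.
Qed.

End OneRelation.

Lemma maximal_isotropic_pinv m n (T : set (V2 F m * V2 F n)) :
  maximal_isotropic T -> maximal_isotropic (rel_pinv T).
Proof.
move=> mT; apply: maximal_isotropicI; first by apply: isotropic_pinv; case: mT.
move=> [x y] h; apply: (maximal_isotropic_orth mT) => -[x' y'] Tq.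
have := h (y', x') Tq; rewrite /rform /= -opprB => /eqP.
by rewrite oppr_eq0 => /eqP.
Qed.

Lemma compact_part_lift_im m n (T : set (V2 F m * V2 F n)) c :
  maximal_isotropic T ->
  (forall y, disc_im T y -> dotp y c = 0) -> exists u, T ((0, u), (0, c)).
Proof.
move=> mT hc; apply: (compact_part_lift (maximal_isotropic_pinv mT)) => y.
by move=> [c' [u' h]]; apply: hc; exists u', c'.
Qed.

Section Composition.
Variables (m n k : card_oo) (T : set (V2 F m * V2 F n)) (S : set (V2 F n * V2 F k)).

Lemma isotropic_comp : isotropic T -> isotropic S -> isotropic (rel_comp S T).
Proof.
move=> [sT iT] [sS iS]; split.
  apply/subspaceP; split.
    by exists 0; split; [exact: (subspace0 sT)|exact: (subspace0 sS)].
  move=> a [x z] [x' z'] [y [h1 h2]] [y' [h1' h2']].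
  exists (a *: y + y'); split.
    exact: (subspaceL a sT h1 h1').
  exact: (subspaceL a sS h2 h2').
move=> [x z] [x' z'] [y [h1 h2]] [y' [h1' h2']].
have := iT _ _ h1 h1'; have := iS _ _ h2 h2'; rewrite /rform /=.
by move=> /eqP; rewrite subr_eq0 => /eqP <- .
Qed.

(** For (v, z) orthogonal to the product, the form
    y' - y'' |-> {v, v'} - {z, z'}, with (v', y') in T and (y'', z') in S, is well defined on im T + dom S; a
    vector y representing it satisfies (v, y) in T and (y, z) in S. *)
Lemma maximal_isotropic_comp : maximal_isotropic T -> maximal_isotropic S ->
  finite_set (disc_im T) -> maximal_isotropic (rel_comp S T).
Proof.
move=> mT mS fA; have [[sT iT] _] := mT; have [[sS iS] _] := mS.
apply: maximal_isotropicI; first exact: isotropic_comp.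
move=> [v z] hvz.
(* v is orthogonal to ker T, so a functional killing the first projection of
   [disc_proj T] kills v.1 *)
have [y1 [u1 [c1 Ty1]]] : exists y1, disc_proj T (v.1, y1).
  apply: contrapT => nP.
  pose M := [set x | exists y, disc_proj T (x, y)].
  have sM : is_subspace M.
    have sP := disc_proj_subspace sT.
    apply/subspaceP; split; first by exists 0; exact: (subspace0 sP).
    move=> a x x' [y h] [y' h']; exists (a *: y + y').
    exact: (subspaceL a sP h h').
  have [phi [phi0 phi1]] := subspace_separation sM nP.
  have [u phiu] := linear_dotp phi.
  have Tu : T ((0, u), (0, 0)).
    apply: compact_part_orth => // x y Pxy.
    by rewrite dotp0r -phiu phi0//; exists y.
  have : rform (v, z) ((0, u), (0, 0)) = 0.
    by apply: hvz; exists (0, 0); split=> //; exact: (subspace0 sS).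
  rewrite /rform /= !sformE /= dotp0l dotp0r !dotp0l !subr0 -phiu phi1 => /eqP.
  by rewrite oner_eq0.
(* vectors of the ball of index j lift to the compact part of T, and {v, -}
   vanishes on these lifts *)
have [j1 hj1] := finite_vd_vc_ball fA; have [j2 hj2] := vd_vc_ball y1.
pose j := maxn j1 j2.
pose G : set (V2 F n * F^o) := [set p | exists v' y' y'' z' c,
  [/\ T (v', y'), S (y'', z'), vc_ball j c, p.1 = y' - y'' + (0, c) &
      p.2 = sform v v' - sform z z']].
have sG : is_subspace G.
  apply/subspaceP; split.
    exists 0, 0, 0, 0, 0; split.
    - exact: (subspace0 sT).
    - exact: (subspace0 sS).
    - exact: (subspace0 (vc_ball_subspace F n j)).
    - by rewrite subr0 add0r.
    - by rewrite !sform0r subr0.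
  move=> a [w t] [w' t'] [v1 [y1' [y1'' [z1 [d1 [h1 h2 h3 /= -> ->]]]]]].
  move=> [v2 [y2' [y2'' [z2 [d2 [k1 k2 k3 /= -> ->]]]]]].
  exists (a *: v1 + v2), (a *: y1' + y2'), (a *: y1'' + y2''),
         (a *: z1 + z2), (a *: d1 + d2); split.
  - exact: (subspaceL a sT h1 k1).
  - exact: (subspaceL a sS h2 k2).
  - exact: (subspaceL a (vc_ball_subspace F n j) h3 k3).
  - have -> : (0, a *: d1 + d2) = a *: (0, d1) + (0, d2) :> V2 F n.
      by apply: injective_projections; rewrite //= scaler0 addr0.
    by rewrite /= !scalerDr scalerN opprD addrACA [X in X + _]addrACA.
  - by rewrite /= !sform_linr /GRing.scale/=; ring.
have [y hy] : exists y, forall w t, G (w, t) -> t = sform y w.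
  apply: (@sform_extension F n j) => //.
    move=> [v' [y' [y'' [z' [c [h1 h2 h3 /= /esym/eqP wE /eqP tE]]]]]].
    have [u Tuc] : exists u, T ((0, u), (0, c)).
      apply: compact_part_lift_im => // y hy; apply: hj1 => //.
      by apply: vc_ball_le h3; exact: leq_maxl.
    have STvz : rel_comp S T (v' + (0, u), z').
      exists y''; split=> //=.
      have -> : y'' = y' + (0, c).
        by move: wE; rewrite addrAC subr_eq0 => /eqP ->.
      exact: (subspaceD sT h1 Tuc).
    have := hvz _ STvz; rewrite /rform /= sformDr [sform v (0, u)]sformE /=.
    rewrite dotp0l subr0 (isotropic_pairing (conj sT iT) Tuc Ty1) hj2; last first.
      by apply: vc_ball_le h3; exact: leq_maxr.
    by rewrite addr0 => t0; move: tE; rewrite t0 oner_eq0.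
  move=> c hc; exists 0, 0, 0, 0, c; split=> //=.
  - exact: (subspace0 sT).
  - exact: (subspace0 sS).
  - by rewrite subr0 add0r.
  - by rewrite !sform0r subr0.
exists y; split.
  apply: (maximal_isotropic_orth mT) => -[v' y'] Tq; rewrite /rform /=.
  rewrite -(hy y' (sform v v')) ?subrr//; exists v', y', 0, 0, 0; split=> //=.
  - exact: (subspace0 sS).
  - by rewrite subr0 addr0.
  - by rewrite sform0r subr0.
apply: (maximal_isotropic_orth mS) => -[y'' z'] Sq; rewrite /rform /=.
apply/eqP; rewrite subr_eq0 -eqr_opp -sformNr; apply/eqP/esym/hy.
exists 0, 0, y'', z', 0; split=> //=.
- exact: (subspace0 sT).
- by rewrite sub0r addr0.
- by rewrite sform0r sub0r.
Qed.

(** The middle discrete coordinate ranges over [disc_im T], and over each of its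
    values the end points form a coset of [disc_im S]. *)
Lemma finite_disc_im_comp : isotropic T -> isotropic S ->
  finite_set (disc_im T) -> finite_set (disc_im S) ->
  finite_set (disc_im (rel_comp S T)).
Proof.
move=> [sT _] [sS _] fT fS.
pose Z y := [set z | disc_proj S (y, z)].
apply: (@sub_finite_set _ _ (\bigcup_(y in disc_im T) Z y)).
  move=> z [u [c [[y d] [/= h1 h2]]]]; exists y; first by exists u, d.
  by exists d, c.
apply: bigcup_finite => // y _.
have [->//|/set0P[z0 [d0 [c0 h0]]]] := eqVneq (Z y) set0.
apply: (@sub_finite_set _ _ [set z0 + z | z in disc_im S]); last exact: finite_image.
move=> z [d [c h]]; exists (z - z0); last by rewrite addrC subrK.
exists (d - d0), (c - c0); have := subspaceB sS h h0.
by rewrite /= [(_, _) - _](_ : _ = ((y - y, d - d0), (z - z0, c - c0)))// subrr.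
Qed.

End Composition.

End Lagrangian.

(** * Codiscrete subspaces and compactness *)
Section Topology.
Variables (F : finFieldType) (m : card_oo).

Lemma nbhs_V2P (v : V2 F m) (U : set (V2 F m)) :
  nbhs v U <-> exists k, forall c, vc_ball k c -> U (v.1, v.2 + c).
Proof.
split.
  move=> [[/= A B] [/= nA nB] ABU].
  pose G : set_system (Vc F m) := filter_from setT
    (fun k => [set v.2 + c | c in @vc_ball F m k]).
  have fG : Filter G.
    apply: filter_from_filter; first by exists 0%N.
    move=> k l _ _; exists (maxn k l) => // _ [c hc <-].
    split; exists c => //; apply: vc_ball_le hc; first exact: leq_maxl.
    exact: leq_maxr.
  have cG : G --> v.2.
    apply/cvg_sup => i V [W [[/= Z oZ <-] Zv] ZV].
    exists (choice.pickle i).+1 => // _ [c hc <-]; apply: ZV => /=.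
    by rewrite [X in Z X](_ : _ = v.2 i + c i)// hc// addr0.
  have [k _ kB] := cG _ nB.
  exists k => c hc; apply: ABU; split=> /=; first exact: nbhs_singleton nA.
  by apply: kB; exists c.
move=> [k kU].
exists ([set v.1], [set d | vc_ball k (d - v.2)]).
  split=> /=; first exact/(@principal_filterP (Vd F m)).
  pose I := fset_set [set i : idx m | (choice.pickle i < k)%N].
  have fk := @finite_pickle_lt m k.
  apply: (@filterS _ _ _ (\bigcap_(i in [set` I]) [set d | d i = v.2 i])).
    move=> d hd j jk; rewrite [LHS](_ : _ = d j - v.2 j)//.
    by apply/eqP; rewrite subr_eq0; apply/eqP/hd; rewrite /= in_fset_set ?inE.
  apply: filter_bigI => i _.
  apply: (@proj_continuous (idx m) (fun=> discrete_topology F) i v.2 [set v.2 i]).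
  exact/(@principal_filterP F).
move=> [x d] [/= -> hd].
have := kU _ hd; congr U.
by apply: injective_projections; rewrite //= addrC subrK.
Qed.

(** A subspace containing a ball is open, hence so are unions of its cosets. *)
Lemma open_of_translates (Z : set (V2 F m)) k : is_subspace Z ->
  (forall c, vc_ball k c -> Z (0, c)) ->
  forall A : set (V2 F m), (forall x z, A x -> Z z -> A (x + z)) -> open A.
Proof.
move=> sZ kZ A hA; rewrite openE => v Av; apply/nbhs_V2P; exists k => c hc.
have := hA _ _ Av (kZ _ hc); congr A.
by apply: injective_projections; rewrite /= ?addr0.
Qed.

Lemma coset_eq_sub (Z : set (V2 F m)) x y : is_subspace Z ->
  coset Z x = coset Z y <-> Z (x - y).
Proof.
move=> sZ; split=> [E|h].
  have : coset Z x x by exists 0; rewrite ?addr0//; exact: subspace0.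
  by rewrite E => -[z hz <-]; rewrite addrC addKr.
apply/seteqP; split=> _ [z hz <-].
  by exists ((x - y) + z); [exact: subspaceD|rewrite addrA [y + _]addrC subrK].
exists (z - (x - y)); first exact: subspaceB.
by rewrite opprB [z + _]addrC !addrA [x + y]addrC addrK.
Qed.

Lemma pi_coset (Z : set (V2 F m)) x y : is_subspace Z ->
  (\pi_(coset_space Z) x)%qT = (\pi_(coset_space Z) y)%qT <-> Z (x - y).
Proof.
move=> sZ; rewrite -coset_eq_sub//; split.
  by move/(eqmodP (coset_equiv Z))/asboolP.
by move=> h; apply/(eqmodP (coset_equiv Z))/asboolP.
Qed.

Lemma codiscreteP (Z : set (V2 F m)) : is_subspace Z ->
  codiscrete Z <-> exists k, forall c, vc_ball k c -> Z (0, c).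
Proof.
move=> sZ; split.
  move=> [_ dZ]; have oZ : open Z.
    have := dZ [set (\pi_(coset_space Z) 0)%qT].
    rewrite /open /= /quotient_open; congr open.
    apply/seteqP; split=> x.
      by move/(pi_coset _ _ sZ); rewrite subr0.
    by move=> Zx; apply/(pi_coset _ _ sZ); rewrite subr0.
  have /nbhs_V2P[k hk] : nbhs 0 Z by apply: open_nbhs_nbhs; split=> //; exact: subspace0.
  by exists k => c /hk; congr Z; apply: injective_projections; rewrite //= ?add0r.
move=> [k kZ]; split.
  rewrite -[Z]setCK; apply: open_closedC; apply: (open_of_translates sZ kZ) => x z /= nx Zz Zxz.
  by apply: nx; rewrite -[x](addrK z); exact: subspaceB.
move=> U; rewrite /open /= /quotient_open.
apply: (open_of_translates sZ kZ) => x z /= Ux Zz.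
have /(pi_coset (x + z) x sZ) E : Z (x + z - x) by rewrite addrC addKr.
by move: Ux; rewrite -E.
Qed.

Lemma closed_sform (v : V2 F m) : closed [set w | sform w v = 0].
Proof.
rewrite -[X in closed X]setCK; apply: open_closedC; rewrite openE => w nw.
have [k hk] := vd_vc_ball v.1; apply/nbhs_V2P; exists k => c hc /= wc.
by apply: nw; move: wc; rewrite /= !sformE /= dotpDr (hk c)// addr0.
Qed.

Lemma compact_Vc : compact [set: Vc F m].
Proof.
have := @tychonoff (idx m) (fun=> discrete_topology F) (fun=> setT).
rewrite (_ : [set f | _] = setT); last by apply/seteqP.
apply=> i; apply: finite_compact; exact: (@finite_finset F setT).
Qed.

End Topology.

(** * Perfect Lagrangian relations *)
Section Perfect.
Variables (F : finFieldType).

Lemma cantor_set_nat (g : set nat -> nat) : injective g -> False.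
Proof.
move=> gI; pose D := [set n | exists S, g S = n /\ ~ S n].
have nD : ~ D (g D) by move=> /[dup] DD [S [/gI ->]]; apply.
by apply: (nD); exists D.
Qed.

Lemma vd_countable m : exists f : Vd F m -> nat, injective f.
Proof.
pose e (x : Vd F m) : seq (idx m * F) :=
  [seq (j, x j : F) | j <- fset_set [set j | x j != 0]].
have eI x y : e x = e y -> forall j, x j != 0 -> x j = y j.
  move=> exy j xj; have : (j, x j : F) \in e x.
    by apply/mapP; exists j => //; rewrite in_fset_set ?inE//; exact: vd_finite.
  by rewrite exy => /mapP[i _ [-> ->]].
exists (@choice.pickle _ \o e) => x y /(pcan_inj choice.pickleK) exy.
apply: vdP => j; have [xj|xj] := eqVneq (x j) 0; last exact: eI.
have [yj|yj] := eqVneq (y j) 0; first by rewrite xj yj.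
by rewrite (eI y x).
Qed.

Lemma finite_vd_bounded m (A : set (Vd F m)) K :
  (forall x j, A x -> (K <= choice.pickle j)%N -> x j = 0) -> finite_set A.
Proof.
move=> hA.
pose gf (f : {ffun 'I_K -> F}) : idx m -> F^o :=
  fun j => if insub (choice.pickle j) is Some i then f i else 0.
have gP f : gf f \in @fin_support F m.
  rewrite inE; apply: sub_finite_set (finite_pickle_lt m K) => j /=.
  by rewrite /gf; case: insubP => //; rewrite eqxx.
pose g f := MkVd (gP f).
have fg : finite_set [set g f | f in setT].
  exact/finite_image/(@finite_finset _ setT).
apply: sub_finite_set fg => x Ax.
pose f0 (i : 'I_K) : F :=
  if @choice.unpickle (idx m) i is Some j then x j else 0.
exists (finfun f0) => //.
apply: vdP => j; rewrite /= /gf; case: insubP => [i _ ij|].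
  by rewrite ffunE /f0 ij choice.pickleK.
by rewrite -leqNgt => jK; rewrite hA.
Qed.

(** The last position of the support of x, here called its leading position. *)
Lemma vd_top m (x : Vd F m) i : x i != 0 -> exists j,
  [/\ x j != 0, (choice.pickle i <= choice.pickle j)%N &
      forall l, (choice.pickle j < choice.pickle l)%N -> x l = 0].
Proof.
move=> xi; pose s := fset_set [set j | x j != 0].
have sE j : (j \in s) = (x j != 0).
  by rewrite in_fset_set; [apply/idP/idP; rewrite inE|exact: vd_finite].
pose P n := `[< exists j, x j != 0 /\ choice.pickle j = n >].
have exP : exists n, P n by exists (choice.pickle i); apply/asboolP; exists i.
have bP n : P n -> (n <= \max_(j <- s) choice.pickle j)%N.
  by move=> /asboolP[j [xj <-]]; rewrite (big_fsetD1 j) ?sE//= leq_max leqnn.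
case: (ex_maxnP exP bP) => _ /asboolP[j [xj <-]] hmax; exists j; split=> //.
  by apply: hmax; apply/asboolP; exists i.
move=> l jl; apply/eqP/negP => /negP xl.
by move: jl; rewrite ltnNge hmax//; apply/asboolP; exists l.
Qed.

Section Dom.
Variables (m n : card_oo) (T : set (V2 F m * V2 F n)).
Hypothesis iT : isotropic T.

(** Let J be the set of leading positions, beyond k, of the elements of
    [disc_dom T].  For a subset of J, its indicator u lies in the k-th ball, so
    (0, u) is related by T to some w.  If two subsets give the same discrete
    part of w, then the difference d of their indicators is orthogonal to
    [disc_dom T]; but an element whose leading position is the first place where
    they differ pairs nontrivially with d.  So the power set of J embeds
    into the countable group Vd, J is finite, and the supports of the elements
    of [disc_dom T] are bounded. *)
Lemma finite_disc_dom k : (forall c, vc_ball k c -> rel_dom T (0, c)) ->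
  finite_set (disc_dom T).
Proof.
move=> kT; have [sT _] := iT.
pose J := [set j | (k <= choice.pickle j)%N /\ exists b, [/\ disc_dom T b, b j != 0 &
  forall i, (choice.pickle j < choice.pickle i)%N -> b i = 0]].
have fJ : finite_set J.
  apply: contrapT => /infiniteP/card_leP/unsquash f.
  pose h i : idx m := \val (f (SigSub (in_setT i))).
  have hJ i : J (h i) by have := valP (f (SigSub (in_setT i))); rewrite inE.
  have hI : injective h.
    move=> i j /val_inj hij.
    exact: (congr1 val ('inj_f (mem_setT _) (mem_setT _) hij)).
  have [enc encI] := vd_countable n.
  pose u (S : set nat) : Vc F m := fun j => (`[< exists2 i, S i & h i = j >])%:R.
  have uE S i : u S (h i) = (`[< S i >])%:R.
    rewrite /u; congr (_%:R); congr nat_of_bool; apply/asbool_equiv_eq.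
    by split=> [[i' Si' /hI <-]|Si]; last by exists i.
  have ku S : rel_dom T (0, u S).
    apply: kT => j jk; rewrite /u; case: asboolP => // -[i _ hij].
    by have [] := hJ i; rewrite hij leqNgt jk.
  pose w S := projT1 (cid (ku S)).
  have wP S : T ((0, u S), w S) by rewrite /w; case: cid.
  apply: (@cantor_set_nat (fun S => enc (w S).1)) => S S' /encI wSS'.
  have Tuu : T ((0, u S - u S'), (0, (w S).2 - (w S').2)).
    have := subspaceB sT (wP S) (wP S'); congr T.
    apply: injective_projections; apply: injective_projections => //=.
      by rewrite subrr.
    by rewrite wSS' subrr.
  have perp b : disc_dom T b -> dotp b (u S - u S') = 0.
    by move=> [a [c h2]]; rewrite (isotropic_pairing iT Tuu h2) dotp0l.
  apply/seteqP; apply: contrapT => neS.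
  pose P l := `[< exists i, choice.pickle (h i) = l /\ u S (h i) != u S' (h i) >].
  have [exP|nP] := pselect (exists l, P l); last first.
    apply: neS; apply/seteqP; apply: funext => i; apply/propext.
    suff : u S (h i) = u S' (h i).
      rewrite !uE; do 2 case: asboolP => //; move=> _ _ /eqP.
        by rewrite oner_eq0.
      by rewrite eq_sym oner_eq0.
    apply/eqP/negPn/negP => ne; apply: nP; exists (choice.pickle (h i)).
    by apply/asboolP; exists i.
  case: (ex_minnP exP) => _ /asboolP[i [<- ne]] hmin.
  have [_ [b [Bb bi btop]]] := hJ i.
  have := perp _ Bb; rewrite (dotpE _ (vd_finite b))// (big_fsetD1 (h i))/=; last first.
    by rewrite in_fset_set ?inE//; exact: vd_finite.
  rewrite big1_fset ?addr0; last first.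
    move=> j; rewrite !inE => /andP[ji _] _.
    have [/btop ->|] := ltnP (choice.pickle (h i)) (choice.pickle j); first by rewrite mul0r.
    rewrite leq_eqVlt => /orP[/eqP/(pcan_inj choice.pickleK) jhi|lt].
      by rewrite jhi eqxx in ji.
    suff -> : (u S - u S') j = 0 by rewrite mulr0.
    rewrite [LHS](_ : _ = u S j - u S' j)//; apply/eqP; rewrite subr_eq0.
    apply/negPn/negP => nej.
    have [l hl] : exists l, h l = j.
      apply: contrapT => nh; move: nej; rewrite /u !asboolF ?eqxx// => -[l _ hl];
        by apply: nh; exists l.
    have := hmin (choice.pickle j); rewrite leqNgt lt; case/(_ _)/notF.
    by apply/asboolP; exists l; rewrite hl.
  move/eqP; rewrite mulf_eq0 (negbTE bi)/= subr_eq0.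
  by rewrite (negbTE ne).
have [K hK] : exists K, forall j, J j -> (choice.pickle j < K)%N.
  exists (\max_(j <- fset_set J) (choice.pickle j).+1)%N => j Jj.
  by rewrite (big_fsetD1 j)/= ?in_fset_set ?inE// leq_max leqnn.
apply: (@finite_vd_bounded _ _ (maxn k K)) => x j Bx; rewrite geq_max => /andP[kj Kj].
apply/eqP/negPn/negP => xj; have [l [xl jl ltop]] := vd_top xj.
have := hK l; rewrite ltnNge (leq_trans Kj jl)/=; apply/not_implyP; split=> //.
by split; [exact: leq_trans jl|exists x].
Qed.

End Dom.

(** Perfection is thereby a purely algebraic condition, stable under products.
    Given finite slices, ker T is a closed subset of the compact space
    [disc_dom T] x Vc, and dom T contains a ball because every vector of the
    compact half orthogonal to [disc_dom T] lifts to T. *)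
Lemma perfect_lagrangianP m n (T : set (V2 F m * V2 F n)) :
  perfect_lagrangian T <->
  [/\ maximal_isotropic T, finite_set (disc_dom T) & finite_set (disc_im T)].
Proof.
have sub_im (T' : set (V2 F m * V2 F n)) : is_subspace T' -> is_subspace (rel_im T').
  move=> sT; apply/subspaceP; split; first by exists 0; exact: (subspace0 sT).
  by move=> a w w' [v h] [v' h']; exists (a *: v + v'); exact: (subspaceL a sT h h').
have sub_dom m' n' (T' : set (V2 F m' * V2 F n')) : is_subspace T' -> is_subspace (rel_dom T').
  move=> sT; apply/subspaceP; split; first by exists 0; exact: (subspace0 sT).
  by move=> a w w' [v h] [v' h']; exists (a *: v + v'); exact: (subspaceL a sT h h').
split.
  move=> [mT _ _ cI cD]; have [iT _] := mT; have [sT _] := iT.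
  have [k hk] := (codiscreteP (sub_dom _ _ _ sT)).1 cD.
  have [l hl] := (codiscreteP (sub_im _ sT)).1 cI.
  split=> //; first exact: finite_disc_dom hk.
  have := finite_disc_dom (isotropic_pinv iT) hl; apply: sub_finite_set.
  by move=> y [u [c h]]; exists c, u.
suff key m' n' (T' : set (V2 F m' * V2 F n')) : maximal_isotropic T' ->
    finite_set (disc_dom T') -> compact (rel_ker T') /\ codiscrete (rel_dom T').
  move=> [mT fD fI]; have [cK cD] := key _ _ T mT fD.
  have [|cK' cD'] := key _ _ _ (maximal_isotropic_pinv mT).
    by apply: sub_finite_set fI => y [u [c h]]; exists c, u.
  by split.
move=> mT fD; have [iT _] := mT; have [sT _] := iT; split.
  apply: (@subclosed_compact _ _ (disc_dom T' `*` [set: Vc F m'])); last 2 first.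
  - by apply: compact_setX; [exact: finite_compact|exact: compact_Vc].
  - by move=> [x c] h; split=> //; exists c, 0.
  have -> : rel_ker T' = \bigcap_(t in T') [set x | sform x t.1 = 0].
    apply/seteqP; split=> x.
      move=> Tx t Tt; have := iT.2 _ _ Tx Tt; rewrite /rform/= [sform 0 _]sformC.
      by rewrite sform0r oppr0 subr0.
    move=> h; apply: (maximal_isotropic_orth mT) => t /h /= xt.
    by rewrite /rform/= xt [sform 0 _]sformC sform0r oppr0 subr0.
  by apply: closed_bigI => t _; exact: closed_sform.
apply/codiscreteP; first exact: sub_dom.
have [k hk] := finite_vd_vc_ball fD; exists k => c hc.
have [d Tcd] := compact_part_lift mT (fun x hx => hk x c hx hc).
by exists (0, d).
Qed.

Lemma perfect_lagrangian_pinv m n (T : set (V2 F m * V2 F n)) :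
  perfect_lagrangian T -> perfect_lagrangian (rel_pinv T).
Proof.
move=> /perfect_lagrangianP[mT fD fI]; apply/perfect_lagrangianP; split.
- exact: maximal_isotropic_pinv.
- by apply: sub_finite_set fI => y [u [c h]]; exists c, u.
- by apply: sub_finite_set fD => y [u [c h]]; exists c, u.
Qed.

Lemma perfect_lagrangian_comp m n k (T : set (V2 F m * V2 F n))
    (S : set (V2 F n * V2 F k)) :
  perfect_lagrangian T -> perfect_lagrangian S ->
  perfect_lagrangian (rel_comp S T).
Proof.
move=> pT pS.
have /perfect_lagrangianP[mT _ fT] := pT; have /perfect_lagrangianP[mS _ fS] := pS.
have /perfect_lagrangianP[mT' _ fT'] := perfect_lagrangian_pinv pT.
have /perfect_lagrangianP[mS' _ fS'] := perfect_lagrangian_pinv pS.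
have [[iT _] [iS _] [iT' _] [iS' _]] := And4 mT mS mT' mS'.
apply/perfect_lagrangianP; split; first exact: maximal_isotropic_comp.
  have := finite_disc_im_comp iS' iT' fS' fT'; apply: sub_finite_set.
  by move=> x [u [c [y [h1 h2]]]]; exists c, u, y.
exact: finite_disc_im_comp.
Qed.

End Perfect.

(** * Square summable functions *)
Local Notation normc := (@ComplexField.Normc.normc _).

Section ComplexNorm.
Variables (R : realType).
Implicit Types (a b : R[i]).

Lemma normcD_le a b : normc (a + b) <= normc a + normc b.
Proof. exact: le_normcD. Qed.

Lemma normc_sum_le (I : Type) (s : seq I) (h : I -> R[i]) :
  normc (\sum_(i <- s) h i) <= \sum_(i <- s) normc (h i).
Proof.
elim: s => [|i s IH]; first by rewrite !big_nil ComplexField.Normc.normc0.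
by rewrite !big_cons (le_trans (normcD_le _ _))// lerD2l.
Qed.

Lemma normc_conj a : normc a^* = normc a.
Proof. by case: a => x y; rewrite /= sqrrN. Qed.

Lemma normc_sqr a : (normc a ^+ 2)%:C%C = a * a^*.
Proof.
case: a => x y; rewrite /= sqr_sqrtr ?addr_ge0 ?sqr_ge0//.
by apply/eqP; rewrite eq_complex /=; apply/andP; split; apply/eqP; ring.
Qed.

End ComplexNorm.

Section EllTwoTheory.
Variables (R : realType) (X : choiceType).
Implicit Types (f g : l2 R X) (A : {fset X}).

Lemma l2norm_ge0 f : 0 <= l2norm f.
Proof. exact: sqrtr_ge0. Qed.

Lemma l2norm_sqr f : l2norm f ^+ 2 = fine (sqnorm f).
Proof. by rewrite sqr_sqrtr// fine_ge0// sqnorm_ge0. Qed.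

Lemma l2_fsum_le f A : \sum_(x <- A) normc (f x) ^+ 2 <= l2norm f ^+ 2.
Proof.
have := sqnorm_ge (f : X -> R[i]^o) (finite_fset A).
rewrite (square_summable_fin (l2_valP f)) lee_fin l2norm_sqr.
by rewrite fsbig_finite//= set_fsetK.
Qed.

Lemma sqnorm_fsum_le (f : X -> R[i]^o) (M : R) :
  (forall A, \sum_(x <- A) normc (f x) ^+ 2 <= M) -> (sqnorm f <= M%:E)%E.
Proof. by move=> h; apply: sqnorm_le => A fA; rewrite fsbig_finite. Qed.

Lemma square_summableI (f : X -> R[i]^o) (M : R) :
  (forall A, \sum_(x <- A) normc (f x) ^+ 2 <= M) -> f \in @square_summable R X.
Proof.
move=> h; rewrite inE; apply: (@le_lt_trans _ _ M%:E); last exact: ltry.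
exact: sqnorm_fsum_le.
Qed.

Lemma l2norm_le f (M : R) : 0 <= M ->
  (forall A, \sum_(x <- A) normc (f x) ^+ 2 <= M ^+ 2) -> l2norm f <= M.
Proof.
move=> M0 h; rewrite -(@ler_pXn2r _ 2)// ?nnegrE// ?l2norm_ge0//.
rewrite l2norm_sqr -lee_fin -(square_summable_fin (l2_valP f)).
exact: sqnorm_fsum_le.
Qed.

Lemma l2_coord_le f x : normc (f x) <= l2norm f.
Proof.
rewrite -(@ler_pXn2r _ 2)// ?nnegrE// ?l2norm_ge0 ?normc_ge0//.
by have := l2_fsum_le f [fset x]%fset; rewrite big_seq_fset1.
Qed.

Lemma l2P f g : (forall x, f x = g x) -> f = g.
Proof. by move=> h; apply: val_inj; apply: funext. Qed.

Lemma l2DE f g x : (f + g) x = f x + g x.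
Proof. by []. Qed.

Lemma l2ZE (a : R[i]) f x : (a *: f) x = a * f x.
Proof. by []. Qed.

Definition l2_delta_fun (x : X) : X -> R[i]^o := fun y => (y == x)%:R.

Fact l2_delta_subproof x : l2_delta_fun x \in @square_summable R X.
Proof.
apply: (@square_summableI _ 1) => A.
have [xA|xA] := boolP (x \in A).
  rewrite (big_fsetD1 x)//= /l2_delta_fun eqxx ComplexField.Normc.normc1 expr1n.
  rewrite big1_fset ?addr0// => y; rewrite !inE => /andP[/negbTE -> _] _.
  by rewrite ComplexField.Normc.normc0 expr0n.
rewrite big1_fset ?ler01// => y yA _; rewrite /l2_delta_fun.
have [E|_] := eqVneq y x; last by rewrite ComplexField.Normc.normc0 expr0n.
by rewrite E (negbTE xA) in yA.
Qed.

Definition l2_delta x : l2 R X := MkL2 (l2_delta_subproof x).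

Lemma l2_sum_delta (s : seq X) (c : X -> R[i]) y : uniq s ->
  (\sum_(x <- s) c x *: l2_delta x : l2 R X) y = if y \in s then c y else 0.
Proof.
elim: s => [|x s IH]; first by rewrite big_nil.
rewrite big_cons /= => /andP[xs us].
rewrite [LHS](_ : _ = c x * (y == x)%:R + (\sum_(x <- s) c x *: l2_delta x : l2 R X) y)//.
rewrite IH// inE; have [->|] := eqVneq y x.
  by rewrite (negbTE xs) mulr1 addr0.
by rewrite mulr0 add0r.
Qed.

Lemma l2_fsum_adherent f (e : R) : 0 < e ->
  exists A, l2norm f ^+ 2 - e < \sum_(x <- A) normc (f x) ^+ 2.
Proof.
move=> e0; have finf := square_summable_fin (l2_valP f).
have [_ [B [fB _] <-]] : exists2 x, [set (\sum_(x \in A) (normc (f x) ^+ 2)%:E)%E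
      | A in fsets [set: X]] x & (sqnorm f - e%:E < x)%E.
  apply: ub_ereal_sup_adherent => //.
  by rewrite [X in X \is a fin_num](_ : _ = sqnorm f)// finf.
rewrite finf fsumEFin// -EFinB lte_fin -l2norm_sqr fsbig_finite//= => hB.
by exists (fset_set B).
Qed.

Lemma l2_density f (e : R) : 0 < e -> exists A,
  l2norm (f - \sum_(x <- A) (f x : R[i]) *: l2_delta x) <= e.
Proof.
move=> e0; have [A hA] := l2_fsum_adherent f (exprn_gt0 2 e0).
exists A; apply: l2norm_le; first exact: ltW.
set g : l2 R X := f - _; move=> C.
have gE x : g x = if x \in A then 0 else f x.
  rewrite [LHS](_ : _ = f x - (\sum_(x <- A) (f x : R[i]) *: l2_delta x : l2 R X) x)//.
  rewrite (@l2_sum_delta A (fun x => f x))//; case: ifP => _; first by rewrite subrr.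
  by rewrite subr0.
clearbody g; have h1 : \sum_(x <- C) normc (g x) ^+ 2 + \sum_(x <- A) normc (f x) ^+ 2 <=
    l2norm f ^+ 2.
  apply: le_trans (l2_fsum_le f (C `|` A)%fset).
  rewrite (big_fsetID _ (fun x => x \in A) C)/= [X in X + _ + _]big1_fset; last first.
    move=> x; rewrite !inE => /andP[_ xA] _.
    by rewrite gE xA ComplexField.Normc.normc0 expr0n.
  rewrite add0r [leRHS](big_fsetID _ (fun x => x \in A) _)/= addrC.
  rewrite le_eqVlt; apply/orP; left; apply/eqP; congr (_ + _); last first.
    apply: eq_fbigl => x; rewrite !inE /=.
    by case: (x \in A); rewrite ?andbF ?andbT ?orbT.
  apply: (@etrans _ _ (\sum_(x <- [fset x in C | x \notin A]%fset) normc (f x) ^+ 2)).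
    rewrite big_seq [RHS]big_seq; apply: eq_bigr => x.
    by rewrite !inE gE => /andP[_ /negbTE ->].
  apply: eq_fbigl => x; rewrite !inE /=.
  by case: (x \in A); rewrite ?andbF ?andbT ?orbF.
rewrite -(lerD2r (\sum_(x <- A) normc (f x) ^+ 2)) (le_trans h1)//.
by move: hA; rewrite ltrBlDr addrC => /ltW; rewrite addrC.
Qed.

(** Finite combinations of deltas are dense.  Only additivity is asked of Phi, so
    that the lemma also serves for antilinear functionals. *)
Lemma l2_bounded_eq0 (Phi : l2 R X -> R[i]) (M : R) :
  (forall f g, Phi (f + g) = Phi f + Phi g) ->
  (forall f, normc (Phi f) <= M * l2norm f) ->
  (forall a x, Phi (a *: l2_delta x) = 0) -> forall f, Phi f = 0.
Proof.
move=> PhiD PhiM Phi0 f; apply: ComplexField.Normc.eq0_normc.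
have P0 : Phi 0 = 0.
  by apply: (addrI (Phi 0)); rewrite -PhiD !addr0.
apply/eqP; rewrite eq_le normc_ge0 andbT; apply/ler_addgt0Pr => e e0.
rewrite add0r; have M1 : 0 < `|M| + 1 by rewrite ltr_wpDl.
have [A hA] := l2_density f (divr_gt0 e0 M1).
set g := \sum_(x <- A) _ in hA.
have Pg : Phi g = 0.
  rewrite /g; elim: (enum_fset A) => [|x s IH]; first by rewrite big_nil.
  by rewrite big_cons PhiD Phi0 IH addr0.
rewrite -(subrK g f) PhiD Pg addr0 (le_trans (PhiM _))//.
apply: (@le_trans _ _ ((`|M| + 1) * l2norm (f - g))).
  by rewrite ler_wpM2r ?l2norm_ge0// (le_trans (ler_norm M))// lerDl.
by rewrite mulrC -ler_pdivlMr.
Qed.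

End EllTwoTheory.

(** * Bounded operators and their kernels *)
Section BoundedOperators.
Variables (R : realType).

Lemma bounded_operator_ge0 (X Y : choiceType) (A : {linear l2 R X -> l2 R Y}) :
  bounded_operator A ->
  exists2 M, 0 <= M & forall f, l2norm (A f) <= M * l2norm f.
Proof.
move=> [M hM]; exists `|M| => // f; apply: le_trans (hM f) _.
by rewrite ler_wpM2r ?l2norm_ge0// ler_norm.
Qed.

Lemma bounded_operator_ext (X Y : choiceType) (A B : {linear l2 R X -> l2 R Y}) c :
  bounded_operator A -> bounded_operator B ->
  (forall x y, A (l2_delta R x) y = c * B (l2_delta R x) y) -> A =1 c \*: B.
Proof.
move=> /bounded_operator_ge0[M M0 hM] /bounded_operator_ge0[N N0 hN] AB f.
apply: l2P => y.
pose Phi (g : l2 R X) : R[i] := A g y - c * B g y.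
suff /(_ f) /eqP : forall g, Phi g = 0 by rewrite subr_eq0 => /eqP.
apply: (@l2_bounded_eq0 _ _ _ (M + normc c * N)).
- by move=> g h; rewrite /Phi !linearD !l2DE mulrDr opprD addrACA.
- move=> g; rewrite mulrDl; apply: le_trans (normcD_le _ _) _; apply: lerD.
    exact: le_trans (l2_coord_le _ _) (hM g).
  rewrite normcN ComplexField.Normc.normcM -mulrA ler_wpM2l ?normc_ge0//.
  exact: le_trans (l2_coord_le _ _) (hN g).
- by move=> a x; rewrite /Phi [A _]linearZ [B _]linearZ !l2ZE AB mulrCA subrr.
Qed.

Lemma bounded_operator_comp (X Y Z : choiceType)
    (A : {linear l2 R X -> l2 R Y}) (B : {linear l2 R Y -> l2 R Z}) :
  bounded_operator A -> bounded_operator B -> bounded_operator (B \o A).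
Proof.
move=> /bounded_operator_ge0[M M0 hM] /bounded_operator_ge0[N N0 hN].
exists (N * M) => f; apply: le_trans (hN _) _.
by rewrite -mulrA ler_wpM2l.
Qed.

Lemma scale_operatorE (X Y : choiceType) c (A : {linear l2 R X -> l2 R Y}) f y :
  (c \*: A : {linear l2 R X -> l2 R Y}) f y = c * A f y.
Proof. by rewrite -l2ZE. Qed.

Lemma bounded_operatorZ (X Y : choiceType) c (A : {linear l2 R X -> l2 R Y}) :
  bounded_operator A -> bounded_operator (c \*: A).
Proof.
move=> /bounded_operator_ge0[M M0 hM]; exists (normc c * M) => f.
rewrite [X in l2norm X <= _](_ : _ = c *: A f)//.
apply: l2norm_le => [|B].
  by rewrite !mulr_ge0 ?normc_ge0 ?l2norm_ge0.
rewrite (eq_bigr (fun y => normc c ^+ 2 * normc (A f y) ^+ 2)).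
  rewrite -mulr_sumr (_ : (normc c * M * l2norm f) ^+ 2 =
    normc c ^+ 2 * (M * l2norm f) ^+ 2); last by rewrite -exprMn mulrA.
  apply: ler_wpM2l; first exact: sqr_ge0.
  apply: le_trans (l2_fsum_le _ _) _.
  by rewrite lerXn2r ?nnegrE ?mulr_ge0 ?l2norm_ge0.
by move=> y _; rewrite l2ZE ComplexField.Normc.normcM exprMn.
Qed.

Lemma linear_sum_delta (X Y : choiceType) (B : {linear l2 R X -> l2 R Y})
    (s : seq X) (c : X -> R[i]) y :
  B (\sum_(x <- s) c x *: l2_delta R x) y = \sum_(x <- s) c x * B (l2_delta R x) y.
Proof.
elim: s => [|x s IH]; first by rewrite !big_nil linear0.
by rewrite !big_cons linearD l2DE IH linearZ l2ZE.
Qed.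

Lemma sqr_sum_le (I : Type) (s : seq I) (a : I -> R) :
  (\sum_(i <- s) a i) ^+ 2 <= (size s)%:R * \sum_(i <- s) a i ^+ 2.
Proof.
rewrite expr2 big_distrlr /=.
apply: (@le_trans _ _ (\sum_(i <- s) \sum_(j <- s) (a i ^+ 2 + a j ^+ 2) / 2)).
  apply: ler_sum => i _; apply: ler_sum => j _.
  by rewrite ler_pdivlMr// -subr_ge0; have := sqr_ge0 (a i - a j); nra.
have sumc (c : R) : \sum_(i <- s) c = (size s)%:R * c.
  by rewrite big_const_seq count_predT iter_addr_0 mulr_natl.
rewrite (eq_bigr (fun i => ((size s)%:R * a i ^+ 2 + \sum_(j <- s) a j ^+ 2) / 2)).
  by rewrite -mulr_suml big_split/= sumc -mulr_sumr; lra.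
by move=> i _; rewrite -mulr_suml big_split/= sumc.
Qed.

(** Schur's test for a kernel with entries of modulus at most 1 and at most a
    nonzero entries in the row of each y, b in the column of each x: by
    Cauchy-Schwarz in each row, and since each |f x|^2 is then counted at most
    b times, the norm is at most sqrt(ab). *)
Lemma kernel_operator (X Y : choiceType) (K : X -> Y -> R[i]) (a b : nat) :
  (forall x y, normc (K x y) <= 1) ->
  (forall y, exists A : {fset X}, (#|` A| <= a)%N /\
     forall x, K x y != 0 -> x \in A) ->
  (forall x, exists B : {fset Y}, (#|` B| <= b)%N /\
     forall y, K x y != 0 -> y \in B) ->
  exists2 A : {linear l2 R X -> l2 R Y}, bounded_operator A &
    forall x y, A (l2_delta R x) y = K x y.
Proof.
move=> K1 /choice[row hrow] /choice[col hcol].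
pose T (f : X -> R[i]^o) : Y -> R[i]^o := fun y => \sum_(x <- row y) K x y * f x.
have TE (C : {fset X}) f y : {subset row y <= C} ->
    T f y = \sum_(x <- C) K x y * f x.
  move=> rC; rewrite /T (big_fsetID _ (fun x => x \in row y) C)/=.
  rewrite [X in _ = _ + X]big1_fset ?addr0.
    apply: eq_fbigl => x; rewrite !inE /=.
    by case: (boolP (x \in row y)) => [/rC ->//|]; rewrite andbF.
  move=> x; rewrite !inE => /andP[_ /negP nx] _.
  have [->|/(hrow y).2//] := eqVneq (K x y) 0; by rewrite mul0r.
have Tle (f : l2 R X) (B : {fset Y}) :
    \sum_(y <- B) normc (T f y) ^+ 2 <= (a * b)%:R * l2norm f ^+ 2.
  pose C := (\bigcup_(y <- B) row y)%fset.
  have rC y : y \in B -> {subset row y <= C}.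
    by move=> yB x xr; apply/bigfcupP; exists y; rewrite ?yB.
  apply: (@le_trans _ _ (\sum_(y <- B) a%:R * \sum_(x <- C) (y \in col x)%:R * normc (f x) ^+ 2)).
    rewrite big_seq [leRHS]big_seq; apply: ler_sum => y yB.
    apply: (@le_trans _ _ ((\sum_(x <- row y) normc (K x y * f x)) ^+ 2)).
      by rewrite lerXn2r ?nnegrE ?normc_ge0 ?sumr_ge0// ?normc_sum_le// => *; exact: normc_ge0.
    apply: le_trans (sqr_sum_le _ _) _.
    apply: ler_pM; [by []|by apply: sumr_ge0 => *; exact: sqr_ge0|by rewrite ler_nat (hrow y).1|].
    have -> : \sum_(x <- C) (y \in col x)%:R * normc (f x) ^+ 2 =
        \sum_(x <- row y) (y \in col x)%:R * normc (f x) ^+ 2 +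
        \sum_(x <- [fset x in C | x \notin row y]%fset) (y \in col x)%:R * normc (f x) ^+ 2.
      rewrite (big_fsetID _ (fun x => x \in row y) C)/=; congr (_ + _).
      apply: eq_fbigl => x; rewrite !inE /=.
      by case: (boolP (x \in row y)) => [/(rC _ yB) ->//|]; rewrite andbF.
    rewrite -[leLHS]addr0 lerD//; last first.
      by apply: sumr_ge0 => x _; rewrite mulr_ge0 ?sqr_ge0.
    apply: ler_sum => x _; have [K0|/(hcol x).2 ->] := eqVneq (K x y) 0.
      by rewrite K0 mul0r ComplexField.Normc.normc0 expr0n mulr_ge0 ?sqr_ge0.
    rewrite mul1r lerXn2r ?nnegrE ?normc_ge0// ComplexField.Normc.normcM.
    by rewrite ler_piMl ?normc_ge0.
  rewrite -mulr_sumr natrM -mulrA ler_wpM2l// exchange_big/=.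
  apply: (@le_trans _ _ (\sum_(x <- C) b%:R * normc (f x) ^+ 2)).
    apply: ler_sum => x _; rewrite -mulr_suml ler_wpM2r ?sqr_ge0//.
    rewrite -natr_sum ler_nat; apply: leq_trans (hcol x).1.
    have -> : (\sum_(y <- B) (y \in col x) =
        size [seq y <- enum_fset B | y \in col x])%N.
      rewrite size_filter -sum1_count [RHS]big_mkcond; apply: eq_bigr => y _.
      by case: (y \in col x).
    apply: uniq_leq_size; first exact/filter_uniq/fset_uniq.
    by move=> y; rewrite mem_filter => /andP[].
  rewrite -mulr_sumr ler_wpM2l//; exact: l2_fsum_le.
have TP (f : l2 R X) : T f \in @square_summable R Y.
  exact: square_summableI (Tle f).
have Tlin : linear (fun f : l2 R X => MkL2 (TP f)).
  move=> c f g; apply: l2P => y.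
  rewrite [RHS](_ : _ = c * T f y + T g y)// /= /T mulr_sumr -big_split/=.
  apply: eq_bigr => x _.
  by rewrite [X in _ * X](_ : _ = c * f x + g x)// mulrDr mulrCA.
pose H := GRing.isLinear.Build _ _ _ _ _ Tlin.
pose A : {linear l2 R X -> l2 R Y} :=
  HB.pack (fun f : l2 R X => MkL2 (TP f)) H.
exists A.
  exists (Num.sqrt (a * b)%:R) => f; apply: l2norm_le.
    by rewrite mulr_ge0 ?sqrtr_ge0 ?l2norm_ge0.
  by move=> B; rewrite exprMn sqr_sqrtr//; exact: Tle.
move=> x y; rewrite /= (TE (row y `|` [fset x])%fset); last first.
  by move=> z; rewrite !inE => ->.
rewrite (big_fsetD1 x)/= ?inE ?eqxx ?orbT// /l2_delta_fun eqxx mulr1.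
rewrite big1_fset ?addr0// => z; rewrite !inE => /andP[/negbTE -> _] _.
by rewrite mulr0.
Qed.

End BoundedOperators.

(** * The inner product and adjoints *)
Section InnerProduct.
Variables (R : realType) (X : choiceType).
Implicit Types (f g : l2 R X) (h : X -> R[i]) (A B : {fset X}).

(** Convergence of the net of finite partial sums, in epsilon form. *)
Definition has_sum h (L : R[i]) : Prop :=
  forall e : R, 0 < e -> exists A, forall B, (A `<=` B)%fset ->
    normc (L - \sum_(x <- B) h x) < e.

Lemma has_sum_sum h L : has_sum h L -> summability.sum (h : X -> R[i]^o) = L.
Proof.
move=> hL; apply: (@cvg_lim R[i]^o).
  exact: norm_hausdorff.
  exact: summability.totally_filter.
have fF : Filter (@summability.totally X).
  by have [] := @summability.totally_filter X.
apply/cvgrPdist_lt => -[e e'] e0.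
have [/eqP e'0 {}e0] : e' == 0 /\ 0 < e by move: e0; rewrite ltcE /= => /andP[].
have [A hA] := hL _ e0; exists A => // B /= AB.
have -> : summability.partial_sum (h : X -> R[i]^o) B = \sum_(x <- B) h x.
  by rewrite big_seq_fsetE.
have := hA _ AB; rewrite e'0; move: (L - _) => z ze.
by rewrite ltcE; case: z ze => p q /= ->; rewrite eqxx.
Qed.

Lemma has_sumD h h' L L' : has_sum h L -> has_sum h' L' ->
  has_sum (fun x => h x + h' x) (L + L').
Proof.
move=> hL hL' e e0; have e2 : 0 < e / 2 by rewrite divr_gt0.
have [A hA] := hL _ e2; have [A' hA'] := hL' _ e2.
exists (A `|` A')%fset => B; rewrite fsubUset => /andP[AB A'B].
rewrite big_split/= opprD addrACA; apply: le_lt_trans (normcD_le _ _) _.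
by rewrite [ltRHS]splitr ltrD ?hA ?hA'.
Qed.

Lemma has_sumZ c h L : has_sum h L -> has_sum (fun x => c * h x) (c * L).
Proof.
move=> hL e e0; have c1 : 0 < normc c + 1 by rewrite ltr_wpDl ?normc_ge0.
have [A hA] := hL _ (divr_gt0 e0 c1); exists A => B AB.
rewrite -mulr_sumr -mulrBr ComplexField.Normc.normcM.
have := hA _ AB; rewrite ltr_pdivlMr//; apply: le_lt_trans.
by rewrite mulrC ler_wpM2l ?normc_ge0// lerDl.
Qed.

Lemma eq_has_sum h h' L L' : h =1 h' -> L = L' -> has_sum h L -> has_sum h' L'.
Proof. by move=> /funext -> ->. Qed.

Lemma has_sum_l2norm f :
  has_sum (fun x => (normc (f x) ^+ 2)%:C%C) (l2norm f ^+ 2)%:C%C.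
Proof.
move=> e e0; have [A hA] := l2_fsum_adherent f e0; exists A => B AB.
have -> : \sum_(x <- B) (normc (f x) ^+ 2)%:C%C =
    (\sum_(x <- B) normc (f x) ^+ 2)%:C%C :> R[i] by rewrite rmorph_sum.
rewrite -rmorphB /= expr0n addr0 sqrtr_sqr ger0_norm ?subr_ge0 ?l2_fsum_le//.
rewrite ltrBlDl -ltrBlDr; apply: lt_le_trans hA _.
rewrite (big_fsetID _ (fun x => x \in A) B)/=.
rewrite [X in X + _](_ : _ = \sum_(x <- A) normc (f x) ^+ 2).
  by rewrite lerDl; apply: sumr_ge0 => x _; exact: sqr_ge0.
apply: eq_fbigl => x; rewrite !inE /=.
by case: (boolP (x \in A)) => [/(fsubsetP AB) ->//|]; rewrite andbF.
Qed.

(** Convergence comes from the polarization identity, which reduces it to the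
    sums of nonnegative terms defining the norms. *)
Lemma has_sum_l2dot f g : has_sum (fun x => f x * (g x)^*) (l2dot f g).
Proof.
suff [L hL] : exists L, has_sum (fun x => f x * (g x)^*) L.
  by rewrite /l2dot (has_sum_sum hL).
have [j [jconj jj]] : exists j : R[i], j^* = - j /\ j * j = -1.
  exists 'i%C; split; apply/eqP; rewrite eq_complex /=.
    by rewrite oppr0 !eqxx.
  by apply/andP; split; apply/eqP; ring.
pose N f1 : R[i] := (l2norm f1 ^+ 2)%:C%C.
exists (4^-1 * (N (f + g) + (-1) * N (f - g) + (j * N (f + j *: g) +
  (- j) * N (f - j *: g)))).
have := has_sumZ 4^-1 (has_sumD
  (has_sumD (has_sum_l2norm (f + g)) (has_sumZ (-1) (has_sum_l2norm (f - g))))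
  (has_sumD (has_sumZ j (has_sum_l2norm (f + j *: g)))
            (has_sumZ (- j) (has_sum_l2norm (f - j *: g))))).
apply: eq_has_sum => // x.
rewrite !normc_sqr; have l2NE (h : l2 R X) : (- h) x = - h x by [].
rewrite !l2DE !l2NE !l2ZE !rmorphD !rmorphN !rmorphM /= jconj.
move: (f x) (g x) => a b; have ha : 4 != 0 :> R[i] by rewrite pnatr_eq0.
apply: (mulfI ha); rewrite mulVKf//.
transitivity (2 * a * b^* + 2 * b * a^* - 2 * (j * j) * a * b^* + 2 * (j * j) * b * a^*).
  by ring.
by rewrite jj; ring.
Qed.

Lemma l2dotE f g L : has_sum (fun x => f x * (g x)^*) L -> l2dot f g = L.
Proof. exact: has_sum_sum. Qed.

Lemma l2dotDl f f' g : l2dot (f + f') g = l2dot f g + l2dot f' g.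
Proof.
apply: l2dotE; apply: eq_has_sum (has_sumD (has_sum_l2dot f g) (has_sum_l2dot f' g)) => //.
by move=> x; rewrite l2DE mulrDl.
Qed.

Lemma l2dotDr f g g' : l2dot f (g + g') = l2dot f g + l2dot f g'.
Proof.
apply: l2dotE; apply: eq_has_sum (has_sumD (has_sum_l2dot f g) (has_sum_l2dot f g')) => //.
by move=> x; rewrite l2DE rmorphD mulrDr.
Qed.

Lemma l2dotZl a f g : l2dot (a *: f) g = a * l2dot f g.
Proof.
apply: l2dotE; apply: eq_has_sum (has_sumZ a (has_sum_l2dot f g)) => //.
by move=> x; rewrite l2ZE mulrA.
Qed.

Lemma l2dotZr a f g : l2dot f (a *: g) = a^* * l2dot f g.
Proof.
apply: l2dotE; apply: eq_has_sum (has_sumZ a^* (has_sum_l2dot f g)) => //.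
by move=> x; rewrite l2ZE rmorphM mulrCA.
Qed.

Lemma l2dot_delta_r f x : l2dot f (l2_delta R x) = f x.
Proof.
apply: l2dotE => e e0; exists [fset x]%fset => B; rewrite fsub1set => xB.
rewrite (big_fsetD1 x)//= /l2_delta_fun eqxx rmorph1 mulr1 big1_fset.
  by rewrite addr0 subrr ComplexField.Normc.normc0.
by move=> y; rewrite !inE => /andP[/negbTE -> _] _; rewrite rmorph0 mulr0.
Qed.

Lemma l2dot_delta_l g x : l2dot (l2_delta R x) g = (g x)^*.
Proof.
apply: l2dotE => e e0; exists [fset x]%fset => B; rewrite fsub1set => xB.
rewrite (big_fsetD1 x)//= /l2_delta_fun eqxx mul1r big1_fset.
  by rewrite addr0 subrr ComplexField.Normc.normc0.
by move=> y; rewrite !inE => /andP[/negbTE -> _] _; rewrite mul0r.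
Qed.

(** Cauchy-Schwarz, from 2ab <= (q/p) a^2 + (p/q) b^2 with p and q the two
    norms; the case where one of them is 0 is trivial. *)
Lemma l2_fsum_mul_le f g B :
  \sum_(x <- B) normc (f x) * normc (g x) <= l2norm f * l2norm g.
Proof.
have [f0|f0] := eqVneq (l2norm f) 0.
  rewrite f0 mul0r big1// => x _.
  have := l2_coord_le f x; rewrite f0 => h.
  by have -> : normc (f x) = 0; [apply/eqP; rewrite eq_le h normc_ge0|rewrite mul0r].
have [g0|g0] := eqVneq (l2norm g) 0.
  rewrite g0 mulr0 big1// => x _.
  have := l2_coord_le g x; rewrite g0 => h.
  by have -> : normc (g x) = 0; [apply/eqP; rewrite eq_le h normc_ge0|rewrite mulr0].
have F0 : 0 < l2norm f by rewrite lt_def f0 l2norm_ge0.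
have G0 : 0 < l2norm g by rewrite lt_def g0 l2norm_ge0.
have hf := l2_fsum_le f B; have hg := l2_fsum_le g B.
move: (l2norm f) (l2norm g) F0 G0 f0 g0 hf hg => p q p0 q0 pn0 qn0 hf hg.
rewrite -(ler_pM2l (ltr0n _ 2 : 0 < 2%:R)) mulr_sumr.
apply: (@le_trans _ _ (\sum_(x <- B) (q / p * normc (f x) ^+ 2 + p / q * normc (g x) ^+ 2))).
  apply: ler_sum => x _; rewrite -subr_ge0.
  rewrite [X in 0 <= X](_ : _ = q / p * (normc (f x) - p / q * normc (g x)) ^+ 2).
    by rewrite mulr_ge0 ?sqr_ge0// divr_ge0 ?ltW.
  by field; rewrite pn0 qn0.
rewrite big_split/= -!mulr_sumr.
apply: (@le_trans _ _ (q / p * p ^+ 2 + p / q * q ^+ 2)).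
  by apply: lerD; rewrite ler_wpM2l// divr_ge0 ?ltW.
by rewrite le_eqVlt; apply/orP; left; apply/eqP; field; rewrite pn0 qn0.
Qed.

Lemma l2dot_le f g : normc (l2dot f g) <= l2norm f * l2norm g.
Proof.
apply/ler_addgt0Pr => e e0; have [A hA] := has_sum_l2dot f g e0.
have := hA _ (fsubset_refl A); set s := \sum_(x <- A) _ => hs.
rewrite -(subrK s (l2dot f g)) addrC (le_trans (normcD_le _ _))//.
apply: lerD; last exact: ltW.
apply: le_trans (normc_sum_le _ _) _; apply: le_trans (l2_fsum_mul_le _ _ A).
by apply: ler_sum => x _; rewrite ComplexField.Normc.normcM normc_conj.
Qed.

End InnerProduct.

Section Adjoint.
Variables (R : realType) (X Y : choiceType).

(** Both sides are bounded sesquilinear forms, so it is enough to compare them on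
    deltas, first in one argument and then in the other. *)
Lemma is_adjointI (A : {linear l2 R X -> l2 R Y}) (B : {linear l2 R Y -> l2 R X}) :
  bounded_operator A -> bounded_operator B ->
  (forall x y, A (l2_delta R x) y = (B (l2_delta R y) x)^*) -> is_adjoint A B.
Proof.
move=> /bounded_operator_ge0[M M0 hM] /bounded_operator_ge0[N N0 hN] AB f g.
have bnd f1 g1 : normc (l2dot (A f1) g1 - l2dot f1 (B g1)) <=
    (M + N) * l2norm f1 * l2norm g1.
  apply: le_trans (normcD_le _ _) _; rewrite mulrDl mulrDl; apply: lerD.
    apply: le_trans (l2dot_le _ _) _; rewrite ler_wpM2r ?l2norm_ge0//.
  rewrite normcN; apply: le_trans (l2dot_le _ _) _.
  by rewrite [N * _]mulrC -mulrA ler_wpM2l ?l2norm_ge0.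
have step y f1 : l2dot (A f1) (l2_delta R y) - l2dot f1 (B (l2_delta R y)) = 0.
  pose Phi f2 := l2dot (A f2) (l2_delta R y) - l2dot f2 (B (l2_delta R y)).
  apply: (@l2_bounded_eq0 _ _ Phi ((M + N) * l2norm (l2_delta R y))).
  - by move=> u v; rewrite /Phi linearD !l2dotDl opprD addrACA.
  - by move=> u; apply: le_trans (bnd _ _) _; rewrite mulrAC.
  - move=> a x; rewrite /Phi [A _]linearZ !l2dotZl l2dot_delta_r l2dot_delta_l.
    by rewrite AB subrr.
apply/eqP; rewrite -subr_eq0; apply/eqP.
pose Phi g1 := l2dot (A f) g1 - l2dot f (B g1).
apply: (@l2_bounded_eq0 _ _ Phi ((M + N) * l2norm f)).
- by move=> u v; rewrite /Phi linearD !l2dotDr opprD addrACA.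
- by move=> u; exact: bnd.
- by move=> a y; rewrite /Phi [B _]linearZ !l2dotZr -mulrBr step mulr0.
Qed.

End Adjoint.

(** * The Heisenberg operators *)
Section Characters.
Variables (R : realType) (F : finFieldType) (Exp : addchar F R).

Lemma addchar0 : Exp 0 = 1.
Proof. by apply: (mulfI (addchar_neq0 Exp 0)); rewrite -addcharD addr0 mulr1. Qed.

Lemma addchar_conj a : (Exp a)^* = Exp (- a).
Proof.
apply: (mulfI (addchar_neq0 Exp a)).
by rewrite -addcharD subrr addchar0 -normc_sqr normc_addchar expr1n.
Qed.

Lemma nontrivial_addchar_eq0 (a : F) : nontrivial Exp ->
  (forall l, Exp (l * a) = 1) -> a = 0.
Proof.
move=> [b b1] h; apply/eqP/negPn/negP => a0; move/eqP: b1; apply.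
by have := h (b / a); rewrite divfK.
Qed.

End Characters.

Section Heisenberg.
Variables (R : realType) (F : finFieldType) (Exp : addchar F R) (m : card_oo).
Implicit Types (v : V2 F m) (f g : l2 R (Vd F m)).

Lemma heisenbergE v f x :
  heisenberg Exp v f x = f (x + v.1) * Exp (dotp x v.2 + 2^-1 * dotp v.1 v.2).
Proof.
rewrite /heisenberg /= /heisenberg_fun; congr (_ * Exp _).
pose A := [set j | x j != 0] `|` [set j | (v.1 : Vd F m) j != 0].
have fA : finite_set A by rewrite finite_setU; split; exact: vd_finite.
rewrite !(dotpE (A := A))//; last 2 first.
- by move=> j h; right.
- by move=> j h; left.
rewrite -(@fsbig_widen _ _ _ _ A setT)//.
  rewrite fsbig_finite//= mulr_sumr -big_split/=; apply: eq_bigr => j _.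
  by rewrite mulrA.
move=> j [_ /= /not_orP[/negP + /negP]]; rewrite !negbK => /eqP -> /eqP ->.
by rewrite mulr0 !mul0r addr0.
Qed.

Lemma heisenbergD v f g :
  heisenberg Exp v (f + g) = heisenberg Exp v f + heisenberg Exp v g.
Proof. by apply: l2P => x; rewrite l2DE !heisenbergE l2DE mulrDl. Qed.

Lemma heisenbergZ v a f : heisenberg Exp v (a *: f) = a *: heisenberg Exp v f.
Proof. by apply: l2P => x; rewrite l2ZE !heisenbergE l2ZE mulrA. Qed.

Lemma heisenberg_norm v f : l2norm (heisenberg Exp v f) <= l2norm f.
Proof.
apply: l2norm_le => [|A]; first exact: l2norm_ge0.
pose tr (x : Vd F m) : Vd F m := x + v.1.
apply: le_trans (l2_fsum_le f [fset tr x | x in A]%fset).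
rewrite big_imfset; last by move=> x y _ _ /addIr.
rewrite le_eqVlt; apply/orP; left; apply/eqP/eq_bigr => x _.
by rewrite heisenbergE ComplexField.Normc.normcM normc_addchar mulr1.
Qed.

Lemma heisenberg_delta v x : 2%:R != 0 :> F ->
  heisenberg Exp v (l2_delta R x) =
  Exp (dotp x v.2 - 2^-1 * dotp v.1 v.2) *: l2_delta R (x - v.1).
Proof.
move=> two; apply: l2P => y; rewrite l2ZE heisenbergE /= /l2_delta_fun.
have -> : (y + v.1 == x) = (y == x - v.1).
  by rewrite [RHS]eq_sym subr_eq eq_sym.
have [->|_] := eqVneq y (x - v.1); last by rewrite mul0r mulr0.
rewrite mul1r mulr1 dotpDl dotpNl; congr (Exp _).
by field.
Qed.

End Heisenberg.

(** * Weil operators *)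
Section WeilKernel.
Variables (R : realType) (F : finFieldType) (Exp : addchar F R).
Hypothesis two : 2%:R != 0 :> F.

Section OneRelation.
Variables (m n : card_oo).
Implicit Types (T : set (V2 F m * V2 F n)).

(** The value does not depend on the lift of (x, y) to T that is chosen: see
    [weil_kernelE]. *)
Definition weil_kernel T (x : Vd F m) (y : Vd F n) : R[i] :=
  let p := xget (0, 0) [set p : Vc F m * Vc F n | T ((x, p.1), (y, p.2))] in
  if `[< disc_proj T (x, y) >] then
    Exp (2^-1 * (dotp x p.1 - dotp y p.2)) else 0.

(** Two lifts differ by an element of T in the compact halves, and isotropy makes
    its contribution to the phase vanish. *)
Lemma weil_kernelE T x u y c : isotropic T -> T ((x, u), (y, c)) ->
  weil_kernel T x y = Exp (2^-1 * (dotp x u - dotp y c)).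
Proof.
move=> [sT iT] h; rewrite /weil_kernel asboolT; last by exists u, c.
have [p] : exists p, xget (0, 0) [set p : Vc F m * Vc F n |
    T ((x, p.1), (y, p.2))] = p by eexists.
have := @xgetPex _ (0, 0) [set p : Vc F m * Vc F n | T ((x, p.1), (y, p.2))].
move=> /(_ (ex_intro _ (u, c) h)) + pE; rewrite pE => /= hp; congr (Exp (_ * _)).
have := iT _ _ h hp; rewrite /rform /= !sformE /= => /eqP.
rewrite subr_eq0 => /eqP E; apply/eqP; rewrite -subr_eq0; apply/eqP.
transitivity (dotp x p.1 - dotp x u - (dotp y p.2 - dotp y c)); first ring.
by rewrite E subrr.
Qed.

Lemma weil_kernel_eq0 T x y : ~ disc_proj T (x, y) -> weil_kernel T x y = 0.
Proof. by move=> h; rewrite /weil_kernel asboolF. Qed.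

Lemma weil_kernel_neq0 T x y : weil_kernel T x y != 0 -> disc_proj T (x, y).
Proof. by move=> h; apply: contrapT => /weil_kernel_eq0 E; rewrite E eqxx in h. Qed.

Lemma weil_kernel00 T : isotropic T -> weil_kernel T 0 0 = 1.
Proof.
move=> iT; rewrite (weil_kernelE iT (subspace0 iT.1)).
by rewrite !dotp0l subrr mulr0 addchar0.
Qed.

Lemma weil_kernel_le1 T x y : normc (weil_kernel T x y) <= 1.
Proof.
rewrite /weil_kernel; case: ifP => _; first by rewrite normc_addchar.
by rewrite ComplexField.Normc.normc0 ler01.
Qed.

(** This functional equation of the kernel is the intertwining relation. *)
Lemma weil_kernel_translate T v w x y : isotropic T -> T (v, w) ->
  weil_kernel T (x + v.1) (y + w.1) = weil_kernel T x y *
  Exp (dotp x v.2 + 2^-1 * dotp v.1 v.2 - dotp y w.2 - 2^-1 * dotp w.1 w.2).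
Proof.
move: v w => [v1 v2] [w1 w2] /= iT Tvw; have [sT oT] := iT.
have [[u [c h]]|nP] := pselect (disc_proj T (x, y)).
  have h' := subspaceD sT h Tvw.
  rewrite (weil_kernelE iT h) (weil_kernelE iT h') -addcharD; congr (Exp _).
  have := oT _ _ h Tvw; rewrite /rform /= !sformE /= => /eqP.
  rewrite subr_eq0 => /eqP E.
  have {}E : dotp v1 u - dotp w1 c = dotp x v2 - dotp y w2.
    apply/eqP; rewrite -subr_eq0; apply/eqP.
    transitivity (dotp y w2 - dotp w1 c - (dotp x v2 - dotp v1 u)); first ring.
    by rewrite E; ring.
  rewrite !dotpDl !dotpDr.
  transitivity (2^-1 * (dotp x u - dotp y c + dotp v1 v2 - dotp w1 w2 +
    (dotp x v2 - dotp y w2) + (dotp v1 u - dotp w1 c))); first by ring.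
  by rewrite E; field.
rewrite [RHS]mulrC !weil_kernel_eq0 ?mulr0// => -[u [c h]]; apply: nP.
exists (u - v2), (c - w2); have := subspaceB sT h Tvw; congr T.
by apply: injective_projections; apply: injective_projections; rewrite /= ?addrK.
Qed.

Lemma weil_operator_exists T : perfect_lagrangian T ->
  exists2 A, weil_operator Exp T A &
    forall x y, A (l2_delta R x) y = weil_kernel T x y.
Proof.
move=> /perfect_lagrangianP[[iT _] fD fI]; have [sT _] := iT.
have sP := disc_proj_subspace sT.
have [A bA kA] : exists2 A : {linear l2 R (Vd F m) -> l2 R (Vd F n)},
    bounded_operator A & forall x y, A (l2_delta R x) y = weil_kernel T x y.
  apply: (@kernel_operator _ _ _ _ #|` fset_set (disc_dom T)| #|` fset_set (disc_im T)|).
  - exact: weil_kernel_le1.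
  - move=> y; have [|A [cA hA]] := @card_slice _ (fset_set (disc_dom T))
      [set x | disc_proj T (x, y)].
      move=> x x' h h'; rewrite in_fset_set// inE /=.
      by have := subspaceB sP h h'; rewrite /disc_dom /= [(_, _) - _](_ : _ = (x - x', y - y))// subrr.
    by exists A; split=> // x /weil_kernel_neq0 /hA.
  - move=> x; have [|A [cA hA]] := @card_slice _ (fset_set (disc_im T))
      [set y | disc_proj T (x, y)].
      move=> y y' h h'; rewrite in_fset_set// inE /=.
      by have := subspaceB sP h h'; rewrite /disc_im /= [(_, _) - _](_ : _ = (x - x, y - y'))// subrr.
    by exists A; split=> // y /weil_kernel_neq0 /hA.
exists A => //; split=> //.
  exists (l2_delta R 0); apply/eqP => A0.
  have := kA 0 0; rewrite A0 weil_kernel00// => /eqP.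
  by rewrite eq_sym oner_eq0.
move=> v w f Tvw; apply: l2P => y.
have [M M0 hM] := bounded_operator_ge0 bA.
pose Phi g := heisenberg Exp w (A g) y - A (heisenberg Exp v g) y.
suff /(_ f)/eqP : forall g, Phi g = 0 by rewrite subr_eq0 => /eqP.
apply: (@l2_bounded_eq0 _ _ _ (M + M)).
- move=> g h; rewrite /Phi linearD !heisenbergD linearD !l2DE opprD.
  by rewrite addrACA.
- move=> g; apply: le_trans (normcD_le _ _) _; rewrite normcN mulrDl.
  apply: lerD; apply: le_trans (l2_coord_le _ _) _.
    exact: le_trans (heisenberg_norm _ _ _) (hM _).
  by apply: le_trans (hM _) _; rewrite ler_wpM2l// heisenberg_norm.
- move=> a x; rewrite /Phi [A (a *: _)]linearZ !heisenbergZ [A (a *: _)]linearZ !l2ZE.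
  rewrite -mulrBr heisenberg_delta// [A (_ *: _)]linearZ l2ZE heisenbergE !kA.
  have {1}-> : x = x - v.1 + v.1 by rewrite subrK.
  rewrite weil_kernel_translate// -mulrA -addcharD.
  apply/eqP; rewrite mulf_eq0; apply/orP; right; rewrite subr_eq0 mulrC.
  apply/eqP; congr (Exp _ * _); rewrite dotpDl dotpNl; by field.
Qed.

(** On [disc_proj T] the value is transported from (0, 0) by the intertwining
    relation.  An element ((0, u), (0, c)) of T and its multiples show that a
    nonzero value is fixed by all Exp(l (x.u - y.c)), so that x.u = y.c; when
    this holds for all such elements, (x, y) is in [disc_proj T]. *)
Lemma weil_operator_kernel T A : nontrivial Exp -> maximal_isotropic T ->
  weil_operator Exp T A -> forall x y,
  A (l2_delta R x) y = A (l2_delta R 0) 0 * weil_kernel T x y.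
Proof.
move=> ntE mT [bA _ hA] x y; have [iT _] := mT; have [sT _] := iT.
have key v w x' y' : T (v, w) ->
    A (l2_delta R x') (y' + w.1) * Exp (dotp y' w.2 + 2^-1 * dotp w.1 w.2) =
    Exp (dotp x' v.2 - 2^-1 * dotp v.1 v.2) * A (l2_delta R (x' - v.1)) y'.
  move=> Tvw; rewrite -heisenbergE (hA _ _ _ Tvw) heisenberg_delta//.
  by rewrite linearZ l2ZE.
have [[u [c h]]|nP] := pselect (disc_proj T (x, y)).
  rewrite (weil_kernelE iT h).
  have := key _ _ x 0 h; rewrite /= add0r dotp0l add0r subrr => E.
  apply: (mulIf (addchar_neq0 Exp (2^-1 * dotp y c))); rewrite E.
  rewrite mulrC -mulrA -addcharD; congr (_ * Exp _); by field.
rewrite weil_kernel_eq0// mulr0; apply/eqP/negPn/negP => A0; apply: nP.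
apply: disc_proj_biorth => // u c h.
apply/eqP; rewrite -subr_eq0; apply/eqP; apply: (nontrivial_addchar_eq0 ntE) => l.
have hl := subspaceZ l sT h.
have := key _ _ x y hl; rewrite /= !scaler0 !dotp0l !mulr0 subr0 !addr0 subr0.
rewrite [RHS]mulrC => /(mulfI A0); rewrite !dotpZr => E.
apply: (mulIf (addchar_neq0 Exp (l * dotp y c))).
by rewrite -addcharD mul1r E; congr (Exp _); ring.
Qed.

Lemma weil_operator00 T A : nontrivial Exp -> maximal_isotropic T ->
  weil_operator Exp T A -> A (l2_delta R 0) 0 != 0.
Proof.
move=> ntE mT wA; apply/eqP => A00; have [bA [f /eqP Af0] _] := wA.
apply: Af0; have -> : A f = (0 \*: A) f.
  apply: bounded_operator_ext => // x y.
  by rewrite (weil_operator_kernel ntE mT wA) A00 mul0r mul0r.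
by rewrite /= scale0r.
Qed.

Lemma weil_operator_unique T A B : nontrivial Exp -> maximal_isotropic T ->
  weil_operator Exp T A -> weil_operator Exp T B ->
  exists2 c : R[i], c != 0 & B =1 c \*: A.
Proof.
move=> ntE mT wA wB; have [bA _ _] := wA; have [bB _ _] := wB.
have A0 := weil_operator00 ntE mT wA; have B0 := weil_operator00 ntE mT wB.
exists (B (l2_delta R 0) 0 / A (l2_delta R 0) 0).
  by rewrite mulf_neq0// invr_eq0.
apply: bounded_operator_ext => // x y.
rewrite (weil_operator_kernel ntE mT wA) (weil_operator_kernel ntE mT wB x).
by rewrite mulrA divfK.
Qed.

End OneRelation.

Lemma weil_kernel_pinv m n (T : set (V2 F m * V2 F n)) x y : isotropic T ->
  weil_kernel (rel_pinv T) y x = (weil_kernel T x y)^*.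
Proof.
move=> iT; have [[u [c h]]|nP] := pselect (disc_proj T (x, y)).
  rewrite (weil_kernelE iT h) (weil_kernelE (isotropic_pinv iT) h).
  by rewrite addchar_conj; congr (Exp _); ring.
rewrite !weil_kernel_eq0 ?rmorph0// => -[c [u h]]; apply: nP.
by exists u, c.
Qed.

(** * Products and adjoints of Weil operators *)
Section GaussSum.
Variables (m n k : card_oo) (T : set (V2 F m * V2 F n)) (S : set (V2 F n * V2 F k)).
Hypothesis ntE : nontrivial Exp.

(** On E = [disc_im T] /\ [disc_dom S] the summand is G(y) = Exp(y.e(y)/2), where
    the form y.e(z) is symmetric by isotropy of T and S.  Thus
    |sum G|^2 = sum over h of G(h) (sum over z of Exp(z.e(h))), and the inner sum
    is |E| for h in the radical, where also G(h) = 1, and 0 for the other h. *)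
Lemma gauss_sum_neq0 : isotropic T -> isotropic S -> finite_set (disc_im T) ->
  \sum_(y <- fset_set (disc_im T)) weil_kernel T 0 y * weil_kernel S y 0 != 0.
Proof.
move=> iT iS fT; have [sT oT] := iT; have [sS oS] := iS.
pose D0 := disc_im T `&` disc_dom S.
have fD0 : finite_set D0 by apply: sub_finite_set fT => y [].
have sD0 : is_subspace D0.
  have sPT := disc_proj_subspace sT; have sPS := disc_proj_subspace sS.
  apply/subspaceP; split; first by split; [exact: (subspace0 sPT)|exact: (subspace0 sPS)].
  move=> a y y' [h1 h2] [h1' h2']; split.
    have := subspaceL a sPT h1 h1'.
    by rewrite /disc_im /= [a *: _ + _](_ : _ = (a *: 0 + 0, a *: y + y'))// scaler0 addr0.
  have := subspaceL a sPS h2 h2'.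
  by rewrite /disc_dom /= [a *: _ + _](_ : _ = (a *: y + y', a *: 0 + 0))// scaler0 addr0.
pose D := fset_set D0.
have DE y : y \in D -> D0 y by rewrite in_fset_set// inE.
have ED y : D0 y -> y \in D by move=> h; rewrite in_fset_set// inE.
have sD : is_subspace [set` D].
  have -> : [set` D] = D0 by apply/seteqP; split=> y; [exact: DE|exact: ED].
  by [].
pose G y := weil_kernel T 0 y * weil_kernel S y 0.
have -> : \sum_(y <- fset_set (disc_im T)) weil_kernel T 0 y * weil_kernel S y 0 =
    \sum_(y <- D) G y.
  rewrite [LHS](big_fsetID _ (fun y => y \in D)) /=.
  rewrite [X in _ + X]big1_fset ?addr0.
    apply: eq_fbigl => y; rewrite !inE /= in_fset_set//.
    by apply/andP/idP => [[]//|yD]; split=> //; rewrite inE; case: (DE _ yD).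
  move=> y; rewrite !inE /= => /andP[yT /negP yD] _.
  have [->|/weil_kernel_neq0 yS] := eqVneq (weil_kernel S y 0) 0; first by rewrite mulr0.
  by case: yD; apply: ED; split=> //; move: yT; rewrite in_fset_set// inE.
(* e y is the difference of the compact parts of lifts of y to S and to T *)
have [|e he] := @choice (Vd F n) (Vc F n) (fun y e => D0 y -> exists u c c' u',
    [/\ T ((0, u), (y, c)), S ((y, c'), (0, u')) & e = c' - c]).
  move=> y; have [[[u [c h1]] [c' [u' h2]]]|nD] := pselect (D0 y).
    by exists (c' - c) => _; exists u, c, c', u'.
  by exists 0.
have GE y : D0 y -> G y = Exp (2^-1 * dotp y (e y)).
  move=> /he[u [c [c' [u' [h1 h2 ->]]]]].
  rewrite /G (weil_kernelE iT h1) (weil_kernelE iS h2) -addcharD; congr (Exp _).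
  by rewrite !dotp0l dotpDr dotpNr; ring.
have esym y z : D0 y -> D0 z -> dotp y (e z) = dotp z (e y).
  move=> /he[u1 [c1 [c1' [u1' [h1 k1 ->]]]]] /he[u2 [c2 [c2' [u2' [h2 k2 ->]]]]].
  have := oT _ _ h1 h2; have := oS _ _ k1 k2.
  rewrite /rform /= !sformE /= !dotp0l subrr sub0r subr0 => /eqP.
  rewrite subr_eq0 => /eqP E1 /eqP; rewrite oppr_eq0 subr_eq0 => /eqP E2.
  by rewrite !dotpDr !dotpNr E1 E2.
have GD y z : D0 y -> D0 z -> G (y + z) = G y * G z * Exp (dotp y (e z)).
  move=> Dy Dz; have Dyz := subspaceD sD0 Dy Dz.
  rewrite !GE// -!addcharD; congr (Exp _); rewrite dotpDl.
  rewrite (esym _ _ Dy Dyz) (esym _ _ Dz Dyz) !dotpDl (esym _ _ Dz Dy).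
  by field.
have Gz y : D0 y -> G y * (G y)^* = 1.
  by move=> Dy; rewrite -normc_sqr GE// normc_addchar expr1n.
have innersum h : D0 h -> G h * \sum_(z <- D) Exp (dotp z (e h)) =
    if `[< forall z, D0 z -> dotp z (e h) = 0 >] then (#|` D|)%:R else 0.
  move=> Dh; case: asboolP => hh.
    rewrite GE// (hh h)// mulr0 addchar0 mul1r big_seq (eq_bigr (fun=> 1)).
      rewrite -big_seq big_const_seq count_predT iter_addr_0; congr (_ *+ _).
    by move=> z zD; rewrite hh ?addchar0//; exact: DE.
  have [z [Dz hz]] : exists z, D0 z /\ dotp z (e h) != 0.
    apply: contrapT => nz; apply: hh => z Dz; apply/eqP/negPn/negP => z0.
    by apply: nz; exists z.
  have [l hl] : exists l, Exp (l * dotp z (e h)) != 1.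
    apply: contrapT => nl; move/eqP: hz; apply.
    apply: (nontrivial_addchar_eq0 ntE) => l; apply/eqP/negPn/negP => hl.
    by apply: nl; exists l.
  have zD : l *: z \in D by apply: ED; exact: subspaceZ.
  have := fset_subspace_translate (fun y => Exp (dotp y (e h))) sD zD.
  rewrite (eq_bigr (fun y => Exp (dotp y (e h)) * Exp (l * dotp z (e h)))).
    rewrite -mulr_suml => E; apply/eqP; rewrite mulf_eq0; apply/orP; right.
    have := hl; apply: contraNT => s0; apply/eqP/(mulfI s0); by rewrite mulr1.
  by move=> y _; rewrite dotpDl dotpZl addcharD.
suff : (\sum_(y <- D) G y) * (\sum_(y <- D) G y)^* != 0.
  by rewrite mulf_eq0 negb_or => /andP[].
rewrite rmorph_sum mulr_sumr /=.
rewrite (eq_big_seq (fun z => \sum_(h <- D) G h * Exp (dotp z (e h)))); last first.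
  move=> z zD; rewrite mulr_suml -(fset_subspace_translate _ sD zD).
  apply: eq_big_seq => h hD; have Dz := DE _ zD; have Dh := DE _ hD.
  rewrite addrC GD//.
  transitivity (G h * Exp (dotp z (e h)) * (G z * (G z)^*)); first by ring.
  by rewrite Gz// mulr1.
rewrite exchange_big/= (eq_big_seq (fun h =>
    (if `[< forall z, D0 z -> dotp z (e h) = 0 >] then (#|` D|) else 0%N)%:R)); last first.
  by move=> h hD; rewrite -mulr_sumr innersum; [case: ifP|exact: DE].
have D0' : 0 \in D by apply: ED; exact: subspace0.
rewrite -natr_sum pnatr_eq0 -lt0n (big_fsetD1 0)//= asboolT.
  by rewrite addn_gt0 cardfs_gt0; apply/orP; left; apply/fset0Pn; exists 0.
move=> z Dz; rewrite esym ?dotp0l//; exact: subspace0.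
Qed.

(** Only nonvanishing needs an argument: the entry at (0, 0) is a Gauss sum. *)
Lemma weil_operator_comp A B : perfect_lagrangian T -> perfect_lagrangian S ->
  weil_operator Exp T A -> weil_operator Exp S B ->
  weil_operator Exp (rel_comp S T) (B \o A).
Proof.
move=> pT pS wA wB.
have /perfect_lagrangianP[mT _ fT] := pT; have /perfect_lagrangianP[mS _ _] := pS.
have [iT _] := mT; have [iS _] := mS.
have kA := weil_operator_kernel ntE mT wA; have kB := weil_operator_kernel ntE mS wB.
have A0 := weil_operator00 ntE mT wA; have B0 := weil_operator00 ntE mS wB.
have [bA _ hA] := wA; have [bB _ hB] := wB; split.
- exact: bounded_operator_comp.
- exists (l2_delta R 0); apply/eqP => E.
  have : (B \o A) (l2_delta R 0) 0 = 0 by rewrite E.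
  rewrite /=.
  have -> : A (l2_delta R 0) = \sum_(y <- fset_set (disc_im T))
      (A (l2_delta R 0) 0 * weil_kernel T 0 y) *: l2_delta R y.
    apply: l2P => y; rewrite (l2_sum_delta (fun y => _ * weil_kernel T 0 y))// kA.
    rewrite in_fset_set//; case: ifPn => //; rewrite notin_setE => ny.
    by rewrite weil_kernel_eq0 ?mulr0.
  rewrite linear_sum_delta (eq_bigr (fun y => A (l2_delta R 0) 0 * B (l2_delta R 0) 0 *
      (weil_kernel T 0 y * weil_kernel S y 0))).
    rewrite -mulr_sumr => /eqP; apply/negP; rewrite !mulf_neq0//.
    exact: gauss_sum_neq0.
  by move=> y _; rewrite (kB y) mulrACA.
- move=> v z f [w [/= h1 h2]].
  by rewrite (hB _ _ _ h2) (hA _ _ _ h1).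
Qed.

End GaussSum.

(** The scalar corrects the kernels, which are conjugate transposed up to their
    values at (0, 0). *)
Lemma weil_operator_adjoint m n (T : set (V2 F m * V2 F n)) A B :
  nontrivial Exp -> perfect_lagrangian T ->
  weil_operator Exp T A -> weil_operator Exp (rel_pinv T) B ->
  exists2 c : R[i], c != 0 & is_adjoint A (c \*: B).
Proof.
move=> ntE /perfect_lagrangianP[mT _ _] wA wB; have [iT _] := mT.
have mT' := maximal_isotropic_pinv mT.
have A0 := weil_operator00 ntE mT wA; have B0 := weil_operator00 ntE mT' wB.
have [bA _ _] := wA; have [bB _ _] := wB.
pose c := (A (l2_delta R 0) 0)^* / B (l2_delta R 0) 0; exists c.
  by rewrite mulf_neq0 ?invr_eq0// conjC_eq0.
apply: is_adjointI => //; first exact: bounded_operatorZ.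
move=> x y; rewrite scale_operatorE.
rewrite (weil_operator_kernel ntE mT wA x).
rewrite (weil_operator_kernel ntE mT' wB y) mulrA divfK// weil_kernel_pinv//.
by rewrite rmorphM /= !conjCK.
Qed.

End WeilKernel.

Theorem theorem1p5 (R : realType) (F : finFieldType) (p : nat)
    (hp : p \in [pchar F]) (hp2 : (2 < p)%N)
    (Exp : addchar F R) (hExp : nontrivial Exp)
    (mu nu kappa : card_oo) :
  (forall T : set (V2 F mu * V2 F nu), perfect_lagrangian T ->
    exists2 A, weil_operator Exp T A &
      forall B, weil_operator Exp T B ->
        exists2 c : R[i], c != 0 & B =1 c \*: A)
  /\
  (forall W : forall m n : card_oo, set (V2 F m * V2 F n) ->
      {linear l2 R (Vd F m) -> l2 R (Vd F n)},
    (forall (m n : card_oo) (T : set (V2 F m * V2 F n)),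
      perfect_lagrangian T -> weil_operator Exp T (W m n T)) ->
    (forall (T : set (V2 F mu * V2 F nu)) (S : set (V2 F nu * V2 F kappa)),
      perfect_lagrangian T -> perfect_lagrangian S ->
      exists2 c : R[i], c != 0 &
        W nu kappa S \o W mu nu T =1 c \*: W mu kappa (rel_comp S T))
    /\
    (forall T : set (V2 F mu * V2 F nu), perfect_lagrangian T ->
      exists2 c : R[i], c != 0 &
        is_adjoint (W mu nu T) (c \*: W nu mu (rel_pinv T)))).
Proof.
have two : 2%:R != 0 :> F.
  by rewrite -(dvdn_pcharf hp) gtnNdvd.
split=> [T pT|W hW].
  have [mT _ _] := (perfect_lagrangianP T).1 pT.
  have [A wA _] := weil_operator_exists Exp two pT.
  by exists A => // B wB; exact: (weil_operator_unique two hExp mT).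
split=> [T S pT pS|T pT].
  have pST := perfect_lagrangian_comp pT pS.
  have [mST _ _] := (perfect_lagrangianP _).1 pST.
  apply: (weil_operator_unique two hExp mST (hW _ _ _ pST)).
  exact: weil_operator_comp (hW _ _ _ pT) (hW _ _ _ pS).
apply: (weil_operator_adjoint two hExp pT (hW _ _ _ pT)).
exact/hW/perfect_lagrangian_pinv.
Qed.
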